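(* Let $G$ be a connected $n$-vertex graph. For any $B\subseteq V(G)$ there exists a simple path in $G$ of length at least $\min\{n-|B|-1,\,2\delta(G-B)\}$. Moreover, there is a polynomial-time algorithm constructing a path of such length.
   Context: Graphs are finite, simple and undirected. For $X\subseteq V(G)$, $G-X$ is the subgraph induced by $V(G)\setminus X$; $\delta(H)$ is the minimum degree of $H$. The length of a path is its number of edges. *)

(* Defs.v *)
From HB Require Import structures.
From mathcomp Require Import all_boot all_order all_algebra.

Set Implicit Arguments.
Unset Strict Implicit.
Unset Printing Implicit Defensive.

(** * Graphs *)

Record sgraph (T : finType) := SGraph {
  edge :> rel T;
  edge_sym : symmetric edge;
  edge_irr : irreflexive edge }.

(** The graph without vertices is not regarded as connected. *)
Definition connectedG (T : finType) (G : sgraph T) : bool :=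
  (0 < #|T|) && [forall x : T, forall y : T, connect G x y].

Definition degree (T : finType) (G : sgraph T) (x : T) : nat :=
  #|[set y | G x y]|.

(** Every degree is smaller than [#|T|], so the initial value [#|T|] of the
    minimum matters only for the graph without vertices. *)
Definition min_degree (T : finType) (G : sgraph T) : nat :=
  \big[minn/#|T|]_(x : T) degree G x.

Section Induced.
Variables (T : finType) (G : sgraph T) (X : {set T}).

Definition induced_edge : rel {x : T | x \in X} :=
  fun x y => G (val x) (val y).

Fact induced_sym : symmetric induced_edge.
Proof. by move=> x y; apply: edge_sym. Qed.

Fact induced_irr : irreflexive induced_edge.
Proof. by move=> x; apply: edge_irr. Qed.

Definition induced : sgraph {x : T | x \in X} :=
  SGraph induced_sym induced_irr.
End Induced.

Definition del_vertices (T : finType) (G : sgraph T) (B : {set T}) :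
  sgraph {x : T | x \in ~: B} := induced G (~: B).

(** A path is given by the sequence of its vertices, which is nonempty. *)
Definition simple_path (T : finType) (G : sgraph T) (p : seq T) : bool :=
  if p is x :: s then path G x s && uniq p else false.

Definition path_length (T : Type) (p : seq T) : nat := (size p).-1.

(** * Random access machines

    Structured programs for the random access machine of Cook and Reckhow:
    [reg] holds the registers, [ram] is an unbounded memory that can be
    addressed indirectly, and [out] is the output printed so far.  Each
    elementary instruction and each test costs one step.  Multiplication is
    not elementary, so the largest bit length in a state grows, beyond the
    constants of the program, by at most one per step; hence polynomially many
    steps at unit cost are polynomially many steps of a Turing machine. *)

Inductive cmd : Type :=
| Const of nat & nat         (* reg x := k *)
| Add of nat & nat & nat     (* reg x := reg y + reg z *)
| Sub of nat & nat & nat     (* reg x := reg y - reg z, truncated at 0 *)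
| Fetch of nat & nat         (* reg x := ram (reg y) *)
| Store of nat & nat         (* ram (reg x) := reg y *)
| Print of nat               (* append reg x to the output *)
| Seq of cmd & cmd
| If of nat & cmd & cmd      (* branch on reg x != 0 *)
| While of nat & cmd.        (* loop as long as reg x != 0 *)

Record state := State {
  reg : nat -> nat;
  ram : nat -> nat;
  out : seq nat }.

Definition upd (f : nat -> nat) (a v : nat) : nat -> nat :=
  fun b => if b == a then v else f b.

Definition set_reg (s : state) (x v : nat) : state :=
  State (upd (reg s) x v) (ram s) (out s).

Definition set_mem (s : state) (a v : nat) : state :=
  State (reg s) (upd (ram s) a v) (out s).

Definition emit (s : state) (v : nat) : state :=
  State (reg s) (ram s) (rcons (out s) v).

(** [exec c s t s'] : started in [s], the program [c] terminates in [s'] after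
    exactly [t] steps. *)
Inductive exec : cmd -> state -> nat -> state -> Prop :=
| exec_Const x k s :
    exec (Const x k) s 1 (set_reg s x k)
| exec_Add x y z s :
    exec (Add x y z) s 1 (set_reg s x (reg s y + reg s z))
| exec_Sub x y z s :
    exec (Sub x y z) s 1 (set_reg s x (reg s y - reg s z))
| exec_Fetch x y s :
    exec (Fetch x y) s 1 (set_reg s x (ram s (reg s y)))
| exec_Store x y s :
    exec (Store x y) s 1 (set_mem s (reg s x) (reg s y))
| exec_Print x s :
    exec (Print x) s 1 (emit s (reg s x))
| exec_Seq c1 c2 s1 s2 s3 t1 t2 :
    exec c1 s1 t1 s2 -> exec c2 s2 t2 s3 -> exec (Seq c1 c2) s1 (t1 + t2) s3
| exec_IfT x c1 c2 s s' t :
    reg s x != 0 -> exec c1 s t s' -> exec (If x c1 c2) s t.+1 s'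
| exec_IfF x c1 c2 s s' t :
    reg s x = 0 -> exec c2 s t s' -> exec (If x c1 c2) s t.+1 s'
| exec_WhileT x c s1 s2 s3 t1 t2 :
    reg s1 x != 0 -> exec c s1 t1 s2 -> exec (While x c) s2 t2 s3 ->
    exec (While x c) s1 (t1 + t2).+1 s3
| exec_WhileF x c s :
    reg s x = 0 -> exec (While x c) s 1 s.

(** The input occupies the first memory cells; everything else is 0. *)
Definition init_state (w : seq nat) : state := State (fun=> 0) (nth 0 w) [::].

Definition computes_in (c : cmd) (w : seq nat) (t : nat) (o : seq nat) : Prop :=
  exists2 s, exec c (init_state w) t s & out s = o.

(** The number of vertices, the characteristic vector of [B], and the adjacency
    matrix of [G] row by row. *)
Definition encode (n : nat) (G : sgraph 'I_n) (B : {set 'I_n}) : seq nat :=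
  n :: [seq nat_of_bool (v \in B) | v <- enum 'I_n]
    ++ [seq nat_of_bool (G u v) | u <- enum 'I_n, v <- enum 'I_n].

(* Main.v *)
Require Import Defs.
From HB Require Import structures.
From mathcomp Require Import all_boot all_order all_algebra.
From mathcomp Require Import zify.

Set Implicit Arguments.
Unset Strict Implicit.
Unset Printing Implicit Defensive.

(** Let [d] be the minimum degree of [H = G - B].  If [H] is disconnected, extend a
    path of [G] between two components of [H] greedily at both ends by vertices
    outside [B].  In the end all [H]-neighbours of the ends lie on the path, and the
    closed [H]-neighbourhoods of the two ends are disjoint, so that the path has at
    least [2 * d + 2] vertices.  If [H] is connected, Dirac's argument works in [H]: a
    path of at most [2 * d] vertices that extends at neither end becomes a cycle when
    a suitable suffix is reversed, and if the cycle misses a vertex of [H], one of its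
    rotations extends.

    The machine labels the vertices with increasing numbers, starting from some [a]
    outside [B] and spreading in [H] first and in [G] afterwards.  If the first stage
    misses a vertex [w] of [H], descending along the labels from [w] to [a] yields a
    path between two components; otherwise the path [a] is taken.  Then [n] rounds of
    extending, closing and rotating follow.  All loops run [n] times, hence the
    running time is polynomial. *)

(** * Composition and iteration of relations *)

Section Relations.
Variable U : Type.
Implicit Types R S : U -> U -> Prop.

(** Moves on paths are modelled as relations because a program may pick any admissible vertex or
    chord; the bounds on path sizes hold for every choice. *)
Definition rcomp R S p q := exists2 r, R p r & S r q.

Fixpoint riter R n p q :=
  if n is m.+1 then exists2 r, riter R m p r & R r q else p = q.

Lemma riter_ind R (I : nat -> U -> Prop) n p q :
  I 0 p -> (forall k r r', k < n -> I k r -> R r r' -> I k.+1 r') ->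
  riter R n p q -> I n q.
Proof.
move=> I0 IS; elim: n q IS => [|n IH] q IS /=; first by move=> <-.
move=> [r Hr Rrq]; apply: (IS n r) => //.
by apply: IH Hr => k r1 r2 lt_kn; apply: IS; apply: ltnW.
Qed.

Lemma riter_total R (I : U -> Prop) n p :
  I p -> (forall r, I r -> exists2 q, R r q & I q) ->
  exists2 q, riter R n p q & I q.
Proof.
move=> Ip HR; elim: n => [|n [r Hr Ir]]; first by exists p.
by have [q Rrq Iq] := HR r Ir; exists q => //; exists r.
Qed.

End Relations.

(** One operation covers all rearrangements: [j = 0] reverses the path, [j = i.+1] closes it along
    the chords at [i], and [j = 1] followed by [j = 0] rotates a closed path by one vertex. *)
Definition rev_suffix (U : Type) j (p : seq U) := take j p ++ rev (drop j p).

(** * Moves on simple paths *)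

Section LongPath.
Variables (T : finType) (G : sgraph T) (B : {set T}).
Implicit Types (p q : seq T) (R S : seq T -> seq T -> Prop).

Local Notation simple := (simple_path G).

(** The edges of [G - B], kept on the full vertex type so that paths of [G] and of [G - B] are
    sequences over the same type. *)
Definition edge_out : rel T := fun x y => [&& G x y, x \notin B & y \notin B].
Local Notation H := edge_out.

Definition avoidsB p := all (fun x => x \notin B) p.

Lemma edge_out_sym : symmetric H.
Proof. by move=> x y; rewrite /H edge_sym [(x \notin B) && _]andbC. Qed.

Lemma connect_out_sym : connect_sym H.
Proof. exact/sym_connect_sym/edge_out_sym. Qed.

(** Only the new vertex must avoid [B]; the path itself may meet [B], as it does when it joins two
    components of [G - B]. *)
Definition extends p v :=
  [&& (if p is x :: s then G (last x s) v else false), v \notin B & v \notin p].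

Definition stuck p := forall v, ~~ extends p v.

Definition closed_path p := if p is x :: s then G (last x s) x else false.

Definition rot_step p := if closed_path p then rot 1 p else p.

(** As [s] is [p] without its head, [nth x s i] is the successor of [nth x p i] on the path: this is
    the pair of chords in Dirac's argument. *)
Definition crosses p i :=
  if p is x :: s then
    [&& i < size s, G x (nth x s i) & G (nth x p i) (last x s)]
  else false.

(** Staying put when stuck makes every round possible, so that a fixed number of rounds can be
    prescribed, as in a bounded loop. *)
Definition ext_rel p q :=
  (exists2 v, extends p v & q = rcons p v) \/ (q = p /\ stuck p).
Definition gext_rel := riter ext_rel #|T|.
Definition rev_rel p q := q = rev p.
Definition cyc_rel p q :=
  (exists2 i, crosses p i & q = rev_suffix i.+1 p)
  \/ (q = p /\ forall i, ~~ crosses p i).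
Definition rot_rel p q := q = rot_step p.
Definition turn_rel := riter (rcomp gext_rel rot_rel) #|T|.
Definition improve_rel :=
  rcomp gext_rel (rcomp rev_rel (rcomp gext_rel (rcomp cyc_rel turn_rel))).

Lemma simple_uniq p : simple p -> uniq p.
Proof. by case: p => //= x s /andP[]. Qed.

Lemma simple_size p : simple p -> size p <= #|T|.
Proof. by move/simple_uniq/card_uniqP => <-; apply: max_card. Qed.

Lemma simple_rcons p v : simple p -> extends p v -> simple (rcons p v).
Proof.
case: p => // x s /andP[xs Us] /and3P[Gv _ v_s].
rewrite rcons_cons; apply/andP; split; first by rewrite rcons_path xs.
by rewrite -rcons_cons rcons_uniq v_s.
Qed.

Lemma simple_rev p : simple p -> simple (rev p).
Proof.
case: p => // x s /andP[xs Us]; rewrite lastI rev_rcons.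
apply/andP; split; last by rewrite -rev_rcons -lastI rev_uniq.
rewrite (eq_path (e' := fun z => G^~ z)) => [|y z]; last exact: edge_sym.
by rewrite rev_path.
Qed.

Lemma cycle_simple p : p != [::] -> cycle G p -> uniq p -> simple p.
Proof. by case: p => // x s _ /=; rewrite rcons_path => /andP[-> _]. Qed.

Lemma closed_cycle p : simple p -> closed_path p = cycle G p.
Proof. by case: p => // x s /andP[xs _] /=; rewrite rcons_path xs. Qed.

Lemma cycle_rot_step k p :
  p != [::] -> cycle G p -> uniq p -> k < size p ->
  rot_step (rot k p) = rot k.+1 p.
Proof.
move=> p0 Cp Up lt_k; rewrite /rot_step closed_cycle ?rot_cycle ?Cp.
  by rewrite -rotS.
by apply: cycle_simple; rewrite ?rot_cycle ?rot_uniq // -size_eq0 size_rot size_eq0.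
Qed.

Lemma perm_rev_suffix j p : perm_eq (rev_suffix j p) p.
Proof. by rewrite -[X in perm_eq _ X](cat_take_drop j) perm_cat2l perm_rev. Qed.

(** The cycle follows [p] up to index [i], jumps along one chord to the last vertex, runs backwards
    to index [i.+1] and returns to the first vertex along the other chord. *)
Lemma crosses_cycle p i : simple p -> crosses p i -> cycle G (rev_suffix i.+1 p).
Proof.
case: p => // x s /andP[xs _] /and3P[lt_i Gx Gl].
move: xs Gx Gl; rewrite /rev_suffix /= -{1 4}(cat_take_drop i s).
rewrite (drop_nth x lt_i); set y := nth x s i; set a := take i s.
(* The predecessor of [y] is the last vertex of [a], or [x] when [a] is empty; [last x a] covers
   both cases. *)
have -> : nth x (x :: s) i = last x a.
  by rewrite (last_nth x) size_take lt_i; case: i @a {y} lt_i => //= i; rewrite nth_take.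
set b := drop _ s; rewrite cat_path last_cat /= rcons_cat cat_path.
move=> /and3P[-> _ yb] Gx Gl.
rewrite lastI rev_rcons /= Gl rcons_path -/(rev _).
rewrite (eq_path (e' := fun z => G^~ z)) => [|u z]; last exact: edge_sym.
rewrite rev_path yb /= edge_sym; case: (b) => //= z b'.
by rewrite rev_cons last_rcons.
Qed.

Lemma rot_step_simple p : simple p -> simple (rot_step p).
Proof.
move=> Sp; rewrite /rot_step; case: ifP => //; rewrite closed_cycle // => Cp.
apply: cycle_simple; rewrite ?rot_cycle ?rot_uniq ?simple_uniq //.
by rewrite -size_eq0 size_rot size_eq0; case: p Sp Cp.
Qed.

(** * Properties preserved by all moves *)

Definition grows R := forall p q, simple p -> R p q ->
  [/\ simple q, size p <= size q & avoidsB p -> avoidsB q].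

Lemma grows_comp R S : grows R -> grows S -> grows (rcomp R S).
Proof.
move=> gR gS p q Sp [r /(gR _ _ Sp)[Sr pr ABr] /(gS _ _ Sr)[Sq rq ABq]].
by split=> // [|/ABr/ABq //]; apply: leq_trans rq.
Qed.

Lemma grows_riter R n : grows R -> grows (riter R n).
Proof.
move=> gR p q Sp.
apply: (@riter_ind _ R (fun _ q => [/\ simple q, size p <= size q & _])) => //.
move=> k r r' _ [Sr pr ABr] /(gR _ _ Sr)[Sr' rr' ABr'].
by split=> // [|/ABr/ABr' //]; apply: leq_trans rr'.
Qed.

Lemma grows_ext : grows ext_rel.
Proof.
move=> p q Sp [[v Ev ->] | [-> _] //]; split; first exact: simple_rcons.
  by rewrite size_rcons.
by rewrite /avoidsB all_rcons; case/and3P: Ev => _ -> _.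
Qed.

Lemma grows_rev : grows rev_rel.
Proof.
by move=> p q Sp ->; rewrite size_rev /avoidsB all_rev; split=> //; apply: simple_rev.
Qed.

Lemma grows_cyc : grows cyc_rel.
Proof.
move=> p q Sp [[i Ci ->] | [-> _] //].
have Pq := perm_rev_suffix i.+1 p; have Sq := perm_size Pq.
split; last by rewrite /avoidsB (perm_all _ Pq).
  apply: cycle_simple; last by rewrite (perm_uniq Pq) simple_uniq.
    by rewrite -size_eq0 Sq; case: (p) Sp.
  exact: crosses_cycle.
by rewrite Sq.
Qed.

Lemma grows_rot : grows rot_rel.
Proof.
move=> p q Sp ->; split; first exact: rot_step_simple.
  by rewrite /rot_step fun_if size_rot if_same.
by rewrite /rot_step; case: ifP => // _; rewrite /avoidsB (perm_all _ (permEl (perm_rot 1 p))).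
Qed.

Lemma grows_gext : grows gext_rel.
Proof. exact/grows_riter/grows_ext. Qed.

Lemma grows_turn : grows turn_rel.
Proof. exact/grows_riter/grows_comp/grows_rot/grows_gext. Qed.

Lemma grows_improve : grows improve_rel.
Proof.
apply: grows_comp grows_gext _; apply: grows_comp grows_rev _.
apply: grows_comp grows_gext _; exact: grows_comp grows_cyc grows_turn.
Qed.

(** A round that is not stuck adds a vertex; [#|T|] additions to a nonempty path would give more
    than [#|T|] distinct vertices. *)
Lemma gext_relP p q : simple p -> gext_rel p q ->
  exists2 s, q = p ++ s & [/\ stuck q, avoidsB s & simple q].
Proof.
move=> Sp Rpq.
pose I k q := exists2 s, q = p ++ s &
  [/\ stuck q \/ k <= size s, avoidsB s & simple q].
have: I #|T| q.
  apply: riter_ind Rpq => [|k r r' _ [s -> [Hs ABs Sr]] [[v Ev ->]|[-> St]]].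
  - by exists [::]; rewrite ?cats0 //; split=> //; right.
  - exists (rcons s v); first by rewrite rcons_cat.
    case: Hs => [/(_ v)/negP[] // | lt_k].
    split; [by right; rewrite size_rcons | | exact: simple_rcons].
    by rewrite /avoidsB all_rcons; case/and3P: Ev => _ -> _.
  - by exists s => //; split=> //; left.
move=> [s def_q [Hs ABs Sq]]; exists s => //; split=> //.
case: Hs => // le_s; have := simple_size Sq; rewrite def_q size_cat.
have : 0 < size p by case: (p) Sp.
by lia.
Qed.

(** * Degree arguments at stuck ends *)

Variable d : nat.
Hypothesis dB : forall x, x \notin B -> d <= #|[set y | H x y]|.

Lemma stuck_nbr x s v :
  stuck (x :: s) -> last x s \notin B -> H (last x s) v -> v \in x :: s.
Proof.
move=> St lB /and3P[Gv _ vB].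
by have := St v; rewrite /extends Gv vB /= negbK.
Qed.

Lemma stuck_rev_nbr x s v :
  stuck (rev (x :: s)) -> x \notin B -> H x v -> v \in x :: s.
Proof.
move=> St xB Hv; rewrite -mem_rev; case/lastP: s St => [|s z] St.
  exact: (stuck_nbr (s := [::])).
rewrite rev_cons rev_rcons rcons_cons in St *.
by apply: stuck_nbr => //; rewrite last_rcons.
Qed.

(** Both closed neighbourhoods in [G - B] lie on the path because the ends are stuck; they are
    disjoint and have at least [d + 1] vertices each. *)
Lemma disconnected_ends x s :
  simple (x :: s) -> stuck (x :: s) -> stuck (rev (x :: s)) ->
  x \notin B -> last x s \notin B -> ~~ connect H x (last x s) ->
  2 * d + 2 <= size (x :: s).
Proof.
move=> Sp St Sr xB lB nxl; set z := last x s in lB nxl *.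
pose N u := u |: [set y | H u y].
have cN u : u \notin B -> d.+1 <= #|N u|.
  move=> uB; rewrite cardsU1 inE /H edge_irr /= add1n ltnS.
  exact: dB.
(* A common vertex would connect the two ends in [G - B]. *)
have NI : N x :&: N z = set0.
  apply/setP=> y; rewrite !inE; apply/negP=> /andP[xy zy]; case/negP: nxl.
  apply: (connect_trans (y := y)).
    by case/orP: xy => [/eqP->|/connect1].
  by rewrite connect_out_sym; case/orP: zy => [/eqP->|/connect1].
have sub : N x :|: N z \subset x :: s.
  apply/subsetP=> y; rewrite !inE => /orP[]/orP[/eqP->|].
  - by rewrite eqxx.
  - by move=> Hy; have := stuck_rev_nbr Sr xB Hy; rewrite inE.
  - by have := mem_last x s; rewrite inE.
  - by move=> Hy; have := stuck_nbr St lB Hy; rewrite inE.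
have := subset_leq_card sub; rewrite (card_uniqP (simple_uniq Sp)).
by rewrite cardsU NI cards0; have := cN _ xB; have := cN _ lB; lia.
Qed.

(** Pigeonhole: [X] indexes the predecessors of the neighbours of the first vertex, [Y] the
    neighbours of the last one. Each has at least [d] elements among the [size p - 1 < 2 * d]
    indices, so they meet. *)
Lemma crossing p :
  simple p -> avoidsB p -> stuck p -> stuck (rev p) -> size p <= 2 * d ->
  exists i, crosses p i.
Proof.
case: p => // x s Sp AB St Sr szp.
have aB y : y \in x :: s -> y \notin B by move/allP: AB; apply.
have xB : x \notin B by apply: aB; rewrite mem_head.
have lB : last x s \notin B by apply: aB; apply: mem_last.
pose X := [set i : 'I_(size s) | G x (nth x s i)].
pose Y := [set i : 'I_(size s) | G (nth x (x :: s) i) (last x s)].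
have cX : d <= #|X|.
  apply: leq_trans (dB xB) _; apply: leq_trans (leq_imset_card (fun i => nth x s (val i)) _).
  apply/subset_leq_card/subsetP=> y; rewrite inE => Hy.
  have := stuck_rev_nbr Sr xB Hy; rewrite inE => /predU1P[yx|y_s].
    by rewrite yx /H edge_irr in Hy.
  have lt_i : index y s < size s by rewrite index_mem.
  by apply/imsetP; exists (Ordinal lt_i); rewrite ?inE /= nth_index //; case/and3P: Hy.
have cY : d <= #|Y|.
  apply: leq_trans (dB lB) _.
  apply: leq_trans (leq_imset_card (fun i => nth x (x :: s) (val i)) _).
  apply/subset_leq_card/subsetP=> y; rewrite inE => Hy.
  have y_p := stuck_nbr St lB Hy.
  (* Only the last vertex has index [size s], and it is not its own neighbour. *)
  have lt_i : index y (x :: s) < size s.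
    have := y_p; rewrite -index_mem /= ltnS leq_eqVlt => /orP[/eqP ey|//].
    have := nth_index x y_p; rewrite -[in index _ _]/(x :: s) /= ey.
    by rewrite -last_nth => ly; rewrite -ly /H edge_irr in Hy.
  apply/imsetP; exists (Ordinal lt_i); rewrite ?inE.
    by rewrite nth_index // edge_sym; case/and3P: Hy.
  by rewrite nth_index.
have /set0Pn[i] : X :&: Y != set0.
  rewrite -card_gt0; have := max_card (mem (X :|: Y)).
  by rewrite cardsU card_ord; rewrite /= in szp; lia.
by rewrite !inE => /andP[Xi Yi]; exists i; rewrite /= ltn_ord Xi Yi.
Qed.

(** * Growth when [G - B] is connected *)

Section Growth.

Hypothesis H_conn : forall x y, x \notin B -> y \notin B -> connect H x y.

(** Each vertex of the cycle is the last one of some rotation. If all rotations are stuck, the cycle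
    is closed under adjacency in [G - B], although some vertex outside [B] is not on it. *)
Lemma cycle_leaves p :
  p != [::] -> cycle G p -> uniq p -> avoidsB p -> size p < #|~: B| ->
  ~ forall k, k <= size p -> stuck (rot k p).
Proof.
move=> p0 Cp Up AB szp St.
have [w wB w_p] : exists2 w, w \notin B & w \notin p.
  have /subsetPn[w wB w_p] : ~~ (~: B \subset p).
    by apply/negP=> /subset_leq_card; rewrite (card_uniqP Up); lia.
  by exists w => //; rewrite inE in wB.
have [x x_p] : exists x, x \in p by case: (p) p0 => // x s; exists x; rewrite mem_head.
have xB : x \notin B by move/allP: AB; apply.
suff cl : closed H [in p].
  by have := closed_connect cl (H_conn xB wB); rewrite x_p (negPf w_p).
apply: (intro_closed connect_out_sym) => u v Huv u_p.
(* This rotation moves [u] to the end. *)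
case/splitPr: u_p St => p1 p2 /(_ (size (rcons p1 u))).
rewrite -cat_rcons rot_size_cat size_cat => /(_ (leq_addr _ _)) St.
suff: v \in p2 ++ rcons p1 u by rewrite !mem_cat orbC.
case: p2 St => [|y p2] St.
  case: p1 St => [|y p1] St; last by rewrite rcons_cons /= in St *;
    apply: stuck_nbr => //; rewrite last_rcons //; case/and3P: Huv.
  by apply: (stuck_nbr (s := [::])) => //; case/and3P: Huv.
rewrite cat_cons in St *; apply: stuck_nbr => //; rewrite last_cat last_rcons //.
by case/and3P: Huv.
Qed.

Lemma turn_grows p q :
  simple p -> cycle G p -> avoidsB p -> size p < #|~: B| ->
  turn_rel p q -> size p < size q.
Proof.
move=> Sp Cp AB szp Rpq; have Up := simple_uniq Sp.
have p0 : p != [::] by case: (p) Sp.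
(* Either the path has grown, or the first [k] rotations were all stuck and the current path is the
   next one. The equation stops at [k = size p], where [rot] has come full circle. *)
pose I k q := [/\ simple q, size p <= size q & size p < size q \/
  (forall j, j < k -> j <= size p -> stuck (rot j p)) /\ (k <= size p -> q = rot k p)].
have: I #|T| q.
  apply: riter_ind Rpq; first by split=> //; right; rewrite rot0.
  move=> k r r' _ [Sr le_r Hr] [t Rrt Rtr'].
  have [St le_t _] := grows_gext Sr Rrt; have [Sr' le_r' _] := grows_rot St Rtr'.
  split=> //; first by lia.
  case: Hr => [|[Hst Hr]]; first by left; lia.
  have [lt_t|ge_t] := ltnP (size p) (size t); first by left; lia.
  right; split=> [j|lt_k]; last first.
    have [s def_t _] := gext_relP Sr Rrt; rewrite Rtr' -(cycle_rot_step p0) //; congr rot_step.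
    rewrite -(Hr (ltnW lt_k)) def_t; have := le_r; have := ge_t; rewrite def_t size_cat.
    by case: (s) => [|? ?]; rewrite ?cats0 //=; lia.
  rewrite ltnS leq_eqVlt => /predU1P[->|]; last exact: Hst.
  move=> le_k; have [s def_t [stt _ _]] := gext_relP Sr Rrt.
  rewrite -Hr //; have := le_r; have := ge_t; rewrite def_t size_cat.
  case: (s) def_t => [|? ?] /=; last by lia.
  by rewrite cats0 => <-.
(* There are [#|T| > size p] rounds, enough to try every rotation. *)
move=> [_ _ []// [Hst _]]; exfalso; apply: (cycle_leaves p0 Cp) => // k le_k.
apply: Hst => //; apply: leq_ltn_trans le_k _; apply: leq_trans szp _; exact: max_card.
Qed.

(** Unless one of the two extensions adds a vertex, the path is stuck at both ends; then a crossing
    closes it to a cycle, and some rotation of the cycle extends. *)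
Lemma improve_grows p q :
  simple p -> avoidsB p -> size p < #|~: B| -> size p <= 2 * d ->
  improve_rel p q -> size p < size q.
Proof.
move=> Sp AB szp szd [p1 R1 [p2 R2 [p3 R3 [p4 R4 R5]]]].
have [S1 le1 AB1] := grows_gext Sp R1; have [S2 le2 AB2] := grows_rev S1 R2.
have [S3 le3 AB3] := grows_gext S2 R3; have [S4 le4 AB4] := grows_cyc S3 R4.
have [_ le5 _] := grows_turn S4 R5.
have [lt3|ge3] := ltnP (size p) (size p3).
  exact: leq_trans (leq_trans lt3 le4) le5.
have [s1 def1 [st1 _ _]] := gext_relP Sp R1.
have [s3 def3 [st3 _ _]] := gext_relP S2 R3.
(* The second extension added nothing, so [p3] is stuck, and so is its reversal [p1]. *)
have def2 : p2 = p3.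
  case: s3 def3 => [|? ?] def3; first by rewrite def3 cats0.
  move: ge3 (leq_trans le1 le2); rewrite def3 size_cat /=; clear; lia.
rewrite R2 in def2.
have AB3' : avoidsB p3 by auto.
have szp3 : size p3 = size p.
  by apply/eqP; rewrite eqn_leq ge3 (leq_trans le1 (leq_trans le2 le3)).
have [i Ci] : exists i, crosses p3 i.
  by apply: crossing; rewrite ?szp3 // -def2 revK.
case: R4 => [[j Cj def4]|[_ /(_ i)]]; last by rewrite Ci.
have sz4 : size p4 = size p by rewrite def4 (perm_size (perm_rev_suffix _ _)).
rewrite -sz4; apply: turn_grows R5 => //; last by rewrite sz4.
  by rewrite def4; apply: crosses_cycle.
by auto.
Qed.

End Growth.

(** * Paths between two components of [G - B] *)

Lemma stuck_catl p q : q != [::] -> stuck q -> stuck (p ++ q).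
Proof.
case: q => // x s _ St v; apply/negP=> /and3P[Gl vB v_p]; case/negP: (St v).
rewrite mem_cat negb_or in v_p; case/andP: v_p => _ v_q; rewrite /extends vB v_q.
by case: p Gl => [|y p] /=; rewrite ?last_cat => ->.
Qed.

Lemma path_out x s : path G x s -> x \notin B -> avoidsB s -> connect H x (last x s).
Proof.
elim: s x => //= y s IH x /andP[xy ys] xB /andP[yB AB].
by apply: connect_trans (IH y ys yB AB); apply: connect1; rewrite /H xy xB yB.
Qed.

Lemma avoidsB_last x s : x \notin B -> avoidsB s -> last x s \notin B.
Proof. by elim: s x => //= y s IH x _ /andP[]; apply: IH. Qed.

(** The vertices added at either end avoid [B], so each new end lies in the component of the old
    one. After both extensions the ends are stuck and still disconnected in [G - B]. *)
Lemma improve_disconnected x s q :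
  simple (x :: s) -> x \notin B -> last x s \notin B -> ~~ connect H x (last x s) ->
  improve_rel (x :: s) q -> 2 * d + 2 <= size q.
Proof.
move=> Sp xB lB nxl [p1 R1 [p2 R2 [p3 R3 [p4 R4 R5]]]].
have [S1 _ _] := grows_gext Sp R1; have [S2 _ _] := grows_rev S1 R2.
have [S3 _ _] := grows_gext S2 R3; have [S4 le4 _] := grows_cyc S3 R4.
have [_ le5 _] := grows_turn S4 R5.
apply: leq_trans le5; apply: leq_trans le4.
have [s1 def1 [st1 AB1 _]] := gext_relP Sp R1.
have [s3 def3 [st3 AB3 _]] := gext_relP S2 R3.
(* In [rev p3] the vertices added last stand in front of [p1], whose stuck end is thus kept. *)
have Sr : stuck (rev p3).
  by rewrite def3 R2 rev_cat revK; apply: stuck_catl => //; rewrite def1.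
have c1 : connect H (last x s) (last x (s ++ s1)).
  rewrite last_cat; apply: path_out => //.
  by move: S1; rewrite def1 /= cat_path => /andP[/andP[]].
have l1 : last x (s ++ s1) \notin B by rewrite last_cat avoidsB_last.
move: def3 S3; rewrite R2 def1 cat_cons lastI rev_rcons cat_cons.
set y := last x (s ++ s1) in c1 l1 *; set u := rev _ => def3 S3.
have lu : last y u = x.
  by rewrite /u; case: (s ++ s1) @y {c1 l1 def3 S3 u} => //= z t; rewrite rev_cons last_rcons.
have S3' := S3; rewrite def3 in S3' st3 Sr *.
have c3 : connect H x (last y (u ++ s3)).
  rewrite last_cat lu; apply: path_out => //.
  by case/andP: S3'; rewrite cat_path lu => /andP[].
apply: disconnected_ends => //; first by rewrite last_cat lu avoidsB_last.
apply/negP=> c; case/negP: nxl; rewrite connect_out_sym.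
by apply: connect_trans c1 (connect_trans c _); rewrite connect_out_sym.
Qed.

(** * Starting paths and iterated improvement *)

Definition promising p :=
  [\/ #|~: B| = 0,
      avoidsB p /\ (forall x y, x \notin B -> y \notin B -> connect H x y)
    | exists x s, [/\ p = x :: s, x \notin B, last x s \notin B
                    & ~~ connect H x (last x s)]].

(** The bound counts vertices, hence one more than the length. In the connected case every round
    gains a vertex until the bound is met; in the disconnected case the first round suffices and
    later ones lose nothing. *)
Lemma improve_promising p q :
  simple p -> promising p -> riter improve_rel #|T| p q ->
  simple q /\ minn #|~: B| (2 * d + 1) <= size q.
Proof.
move=> Sp Pp Rpq; have [Sq _ _] := grows_riter grows_improve Sp Rpq; split=> //.
case: Pp => [-> | [ABp Hconn] | [x [s [def_p xB lB nxl]]]]; first by rewrite min0n.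
  pose I k q := [/\ simple q, avoidsB q &
    minn #|~: B| (2 * d + 1) <= size q \/ k < size q].
  have: I #|T| q.
    apply: riter_ind Rpq; first by split=> //; right; case: (p) Sp.
    move=> k r r' _ [Sr ABr Hr] Rrr'.
    have [Sr' le_r ABr'] := grows_improve Sr Rrr'; split=> //; first exact: ABr'.
    have [|lt_r] := leqP (minn #|~: B| (2 * d + 1)) (size r); first by left; lia.
    right; have := @improve_grows Hconn _ _ Sr ABr _ _ Rrr'; lia.
  by case=> _ _ [//|]; have := simple_size Sq; lia.
pose I k q := simple q /\ (if k is 0 then q = p else 2 * d + 2 <= size q).
have: I #|T| q.
  apply: riter_ind Rpq => // k r r' _ [Sr Hr] Rrr'.
  have [Sr' le_r _] := grows_improve Sr Rrr'; split=> //.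
  case: k Hr => [def_r|k]; last by lia.
  by rewrite def_r def_p in Sr Rrr'; apply: improve_disconnected Rrr'.
(* At least one round takes place. *)
have: 0 < #|T| by apply/card_gt0P; exists x.
by case=> T_gt0 [_]; case: #|T| T_gt0 => //= _ _; lia.
Qed.

Lemma rcomp_total R S p :
  (forall p, simple p -> exists2 q, R p q & simple q) ->
  (forall p, simple p -> exists2 q, S p q & simple q) ->
  simple p -> exists2 q, rcomp R S p q & simple q.
Proof. by move=> tR tS /tR[r Rr /tS[q Sq]]; exists q => //; exists r. Qed.

(** For existence without the machine: each simple path admits an improvement, so improvements can
    be chained. *)
Lemma improve_total p : simple p -> exists2 q, improve_rel p q & simple q.
Proof.
have t_gext p' : simple p' -> exists2 q, gext_rel p' q & simple q.
  move=> Sp'; apply: riter_total => // r Sr.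
  have [v Ev | St] := pickP (extends r).
    by exists (rcons r v); [left; exists v | apply: simple_rcons].
  by exists r => //; right; split=> // v; rewrite St.
have t_cyc p' : simple p' -> exists2 q, cyc_rel p' q & simple q.
  move=> Sp'; case E: [exists i : 'I_(size p'), crosses p' i].
    have [i Ci] := existsP E.
    have Rq : cyc_rel p' (rev_suffix i.+1 p') by left; exists i.
    by exists (rev_suffix i.+1 p') => //; case: (grows_cyc Sp' Rq).
  exists p' => //; right; split=> // i; apply/negP=> Ci; case/existsP: E.
  have lt_i : i < size p' by case: (p') Ci => //= x s /andP[] /leqW.
  by exists (Ordinal lt_i).
apply: rcomp_total => // {}p; apply: rcomp_total => {}p.
  by move=> Sp; exists (rev p) => //; apply: simple_rev.
apply: rcomp_total => // {}p; apply: rcomp_total => // {}p Sp.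
apply: riter_total => // r; apply: rcomp_total => // {}r Sr.
by exists (rot_step r) => //; apply: rot_step_simple.
Qed.

Lemma promising1 a :
  a \notin B -> (forall v, v \notin B -> connect H a v) -> promising [:: a].
Proof.
move=> aB ca; apply: Or32; split=> [|x y xB yB]; first by rewrite /avoidsB /= aB.
by apply: connect_trans (ca y yB); rewrite connect_out_sym ca.
Qed.

Lemma promising_exists : connectedG G -> exists2 p, simple p & promising p.
Proof.
case/andP=> /card_gt0P[x _] /forallP Gc.
have [a aB | allB] := pickP [in ~: B]; last first.
  by exists [:: x] => //; apply/Or31/eq_card0.
rewrite inE in aB; have [w | cl] := pickP [pred w | (w \notin B) && ~~ connect H a w].
  case/andP=> wB naw; have /connectP[s' + def_w] := forallP (Gc a) w.
  move=> as'; case/shortenP: as' def_w => s as_ Us _ def_w.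
  exists (a :: s); first by rewrite /= as_.
  by apply: Or33; exists a, s; rewrite -def_w.
exists [:: a] => //; apply: promising1 => // v vB.
by have := cl v; rewrite /= vB => /negbFE.
Qed.

End LongPath.

(** * Minimum degree of [G - B] and existence of the path *)

Lemma min_degree_le (T : finType) (G : sgraph T) x : min_degree G <= degree G x.
Proof.
rewrite /min_degree; have: x \in index_enum T by exact: mem_index_enum.
elim: (index_enum T) => //= y r IH; rewrite inE big_cons => /predU1P[<-|/IH]; lia.
Qed.

Lemma min_degree_del (T : finType) (G : sgraph T) (B : {set T}) x :
  x \notin B -> min_degree (del_vertices G B) <= #|[set y | edge_out G B x y]|.
Proof.
move=> xB; have x_nB : x \in ~: B by rewrite inE.
apply: leq_trans (min_degree_le _ (exist _ x x_nB)) _.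
rewrite /degree -(card_imset _ val_inj); apply/subset_leq_card/subsetP=> y.
case/imsetP=> [[z zB]]; rewrite !inE /= /induced_edge /= => Gxz ->.
have : z \in ~: B by [].
by rewrite /edge_out Gxz xB in_setC.
Qed.

Lemma long_path_exists (T : finType) (G : sgraph T) (B : {set T}) :
  connectedG G ->
  exists p : seq T,
    simple_path G p /\
    minn (#|T| - #|B| - 1) (2 * min_degree (del_vertices G B)) <= path_length p.
Proof.
move=> Gc; have [p Sp Pp] := promising_exists B Gc.
have [q Rq _] := riter_total (I := simple_path G) #|T| Sp (@improve_total _ G B).
have [Sq le_q] := improve_promising (@min_degree_del _ G B) Sp Pp Rq.
(* The number of vertices is one more than the length, and [#|~: B|] is [#|T| - #|B|]. *)
by exists q; split=> //; rewrite /path_length; have := cardsC B; lia.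
Qed.

(** * Programs with bounded loops *)

(** Register 0 holds the bound of all loops and register 1 the constant 1;
    [PFor i b] counts with register [i] and tests with register [i.+1]. *)
Inductive prog : Type :=
| PConst of nat & nat
| PAdd of nat & nat & nat
| PSub of nat & nat & nat
| PFetch of nat & nat
| PStore of nat & nat
| PPrint of nat
| PSeq of prog & prog
| PIf of nat & prog & prog
| PFor of nat & prog.

Notation "a ;; b" := (PSeq a b) (at level 90, right associativity).

Fixpoint code (c : prog) : cmd :=
  match c with
  | PConst x k => Const x k
  | PAdd x y z => Add x y z
  | PSub x y z => Defs.Sub x y z
  | PFetch x y => Fetch x y
  | PStore x y => Store x y
  | PPrint x => Print x
  | PSeq a b => Seq (code a) (code b)
  | PIf x a b => If x (code a) (code b)
  | PFor i b =>
    Seq (Const i 0) (Seq (Defs.Sub i.+1 0 i)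
      (While i.+1 (Seq (code b) (Seq (Add i i 1) (Defs.Sub i.+1 0 i)))))
  end.

Definition countdown i s := set_reg s i.+1 (reg s 0 - reg s i).
Definition start i s := countdown i (set_reg s i 0).
Definition tick i s := countdown i (set_reg s i (reg s i + reg s 1)).

(** As all loops are bounded, the final state is a total function of the initial one; correctness is
    proved about [den] and transferred by [code_exec]. *)
Fixpoint den (c : prog) (s : state) : state :=
  match c with
  | PConst x k => set_reg s x k
  | PAdd x y z => set_reg s x (reg s y + reg s z)
  | PSub x y z => set_reg s x (reg s y - reg s z)
  | PFetch x y => set_reg s x (ram s (reg s y))
  | PStore x y => set_mem s (reg s x) (reg s y)
  | PPrint x => emit s (reg s x)
  | PSeq a b => den b (den a s)
  | PIf x a b => if reg s x != 0 then den a s else den b s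
  | PFor i b => iter (reg s 0) (fun s => tick i (den b s)) (start i s)
  end.

Fixpoint writes (c : prog) (r : nat) : bool :=
  match c with
  | PConst x _ | PAdd x _ _ | PSub x _ _ | PFetch x _ => r == x
  | PStore _ _ | PPrint _ => false
  | PSeq a b | PIf _ a b => writes a r || writes b r
  | PFor i b => [|| r == i, r == i.+1 | writes b r]
  end.

Fixpoint pure (c : prog) : bool :=
  match c with
  | PStore _ _ | PPrint _ => false
  | PSeq a b | PIf _ a b => pure a && pure b
  | PFor _ b => pure b
  | _ => true
  end.

(** Registers 0 and 1 stay fixed and no loop body touches its own counter or test; with 1 in
    register 1, each compiled loop then runs exactly [reg s 0] times. *)
Fixpoint wf (c : prog) : bool :=
  match c with
  | PConst x _ | PAdd x _ _ | PSub x _ _ | PFetch x _ => 1 < x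
  | PStore _ _ | PPrint _ => true
  | PSeq a b | PIf _ a b => wf a && wf b
  | PFor i b => [&& 1 < i, ~~ writes b i, ~~ writes b i.+1 & wf b]
  end.

(** A polynomial in a bound on register 0. Each round pays 3 for its test, the increment and the
    countdown; 3 more pay for the initialisation and the failing test. A branching is charged for
    both branches. *)
Fixpoint cost (c : prog) : {poly nat} :=
  match c with
  | PSeq a b => (cost a + cost b)%R
  | PIf _ a b => (cost a + cost b + 1)%R
  | PFor _ b => ('X * (cost b + 3%:P) + 3%:P)%R
  | _ => 1%R
  end.

Lemma reg_set s x v y : reg (set_reg s x v) y = if y == x then v else reg s y.
Proof. by []. Qed.

Lemma reg_tick i s r : r != i -> r != i.+1 -> reg (tick i s) r = reg s r.
Proof. by rewrite /tick /countdown !reg_set => /negPf-> /negPf->. Qed.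

Lemma reg_start i s r : r != i -> r != i.+1 -> reg (start i s) r = reg s r.
Proof. by rewrite /start /countdown !reg_set => /negPf-> /negPf->. Qed.

Lemma reg_tick_ctr i s : reg (tick i s) i = reg s i + reg s 1.
Proof. by rewrite /tick /countdown !reg_set eqxx ltn_eqF. Qed.

Lemma reg_start_ctr i s : reg (start i s) i = 0.
Proof. by rewrite /start /countdown !reg_set eqxx ltn_eqF. Qed.

Lemma reg_tick_test i s :
  0 < i -> reg (tick i s) i.+1 = reg s 0 - (reg s i + reg s 1).
Proof. by move=> i_gt0; rewrite /tick /countdown !reg_set !eqxx ltn_eqF. Qed.

Lemma reg_start_test i s : 0 < i -> reg (start i s) i.+1 = reg s 0.
Proof. by move=> i_gt0; rewrite /start /countdown !reg_set !eqxx ltn_eqF ?subn0. Qed.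

Lemma ram_tick i s : ram (tick i s) = ram s.
Proof. by []. Qed.

Lemma out_tick i s : out (tick i s) = out s.
Proof. by []. Qed.

Lemma ram_start i s : ram (start i s) = ram s.
Proof. by []. Qed.

Lemma out_start i s : out (start i s) = out s.
Proof. by []. Qed.

Lemma ram_set_reg s x v : ram (set_reg s x v) = ram s.
Proof. by []. Qed.

Lemma out_set_reg s x v : out (set_reg s x v) = out s.
Proof. by []. Qed.

Lemma reg_set_mem s a v : reg (set_mem s a v) = reg s.
Proof. by []. Qed.

Lemma ram_set_mem s a v b : ram (set_mem s a v) b = if b == a then v else ram s b.
Proof. by []. Qed.

Lemma out_set_mem s a v : out (set_mem s a v) = out s.
Proof. by []. Qed.

Lemma emitE s v :
  (reg (emit s v) = reg s) * (ram (emit s v) = ram s) * (out (emit s v) = rcons (out s) v).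
Proof. by []. Qed.

Definition stateE := (ram_tick, out_tick, ram_start, out_start, reg_set, ram_set_reg,
  out_set_reg, reg_set_mem, ram_set_mem, out_set_mem, emitE).

(* Otherwise unification runs the programs. *)
Opaque set_reg set_mem emit start tick.

(** * Frame properties, running time and the loop rule *)

Lemma den_reg c s r : ~~ writes c r -> reg (den c s) r = reg s r.
Proof.
elim: c s => //= [x k|x y z|x y z|x y|a IHa b IHb|x a IHa b IHb|i b IH] s;
  rewrite ?negb_or ?stateE //.
- by move/negPf->.
- by move/negPf->.
- by move/negPf->.
- by move/negPf->.
- by case/andP=> wa wb; rewrite IHb ?IHa.
- by case/andP=> wa wb; case: ifP; rewrite ?IHb ?IHa.
case/and3P=> ri ri1 wb; elim: (reg s 0) => [|n IHn] /=; first by rewrite reg_start.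
by rewrite reg_tick ?IH.
Qed.

Lemma den_pure c s : pure c -> ram (den c s) = ram s /\ out (den c s) = out s.
Proof.
elim: c s => //= [a IHa b IHb|x a IHa b IHb|i b IH] s.
- by case/andP=> pa pb; have [-> ->] := IHb (den a s) pb; apply: IHa.
- by case/andP=> pa pb; case: ifP => _; [apply: IHa | apply: IHb].
move=> pb; elim: (reg s 0) => [|n [IHr IHo]] /=; rewrite !stateE //.
by have [rE oE] := IH (iter n (fun s => tick i (den b s)) (start i s)) pb; rewrite rE oE.
Qed.

Lemma wf_writes c r : wf c -> r < 2 -> ~~ writes c r.
Proof.
by move=> + lt_r; elim: c => //= *; lia.
Qed.

Lemma code_exec c s m :
  wf c -> reg s 1 = 1 -> reg s 0 <= m ->
  exists2 t, t <= ((cost c).[m])%R & exec (code c) s t (den c s).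
Proof.
elim: c s => /=.
1-6: by move=> *; exists 1; [rewrite hornerC | constructor].
- move=> a IHa b IHb s /andP[wa wb] r1 r0.
  have [t1 le1 e1] := IHa s wa r1 r0.
  have [||t2 le2 e2] := IHb (den a s) wb; rewrite ?den_reg ?wf_writes //.
  exists (t1 + t2); last exact: exec_Seq e1 e2.
  by rewrite hornerD; apply: leq_add.
- move=> x a IHa b IHb s /andP[wa wb] r1 r0; rewrite !hornerD hornerC.
  case: ifP => [rx|/negbFE/eqP rx].
    have [t le e] := IHa s wa r1 r0; exists t.+1; last exact: exec_IfT.
    by move: le; rewrite /GRing.add /=; lia.
  have [t le e] := IHb s wb r1 r0; exists t.+1; last exact: exec_IfF.
  by move: le; rewrite /GRing.add /=; lia.
move=> i b IH s /and4P[lt_i wi wi1 wb] r1 r0.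
set step := fun s => tick i (den b s).
set w := While _ _.
(* [k] is the number of remaining rounds, which the test register shows. *)
have loop k s' : reg s' i.+1 = k -> reg s' i + k = reg s 0 -> reg s' 1 = 1 ->
    reg s' 0 = reg s 0 ->
  exists2 t, t <= k * ((cost b).[m]%R + 3) + 1 & exec w s' t (iter k step s').
  elim: k s' => [|k IHk] s' ri1 ri r1' r0'.
    by exists 1 => //; apply: exec_WhileF.
  have [||t1 le1 e1] := IH s' wb; rewrite ?r0' //.
  have rbi : reg (den b s') i = reg s' i by rewrite den_reg.
  have rb1 : reg (den b s') 1 = 1 by rewrite den_reg ?wf_writes.
  have rb0 : reg (den b s') 0 = reg s 0 by rewrite den_reg ?wf_writes.
  have si : reg (step s') i = (reg s' i).+1.
    by rewrite /step reg_tick_ctr rbi rb1 addn1.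
  have [||||t2 le2 e2] := IHk (step s').
  - by rewrite /step reg_tick_test ?rbi ?rb1 ?rb0; lia.
  - by rewrite si; lia.
  - by rewrite reg_tick //; lia.
  - by rewrite reg_tick //; lia.
  exists (t1 + (1 + 1) + t2).+1; first by lia.
  rewrite iterSr; apply: exec_WhileT e2; first by rewrite ri1.
  apply: exec_Seq e1 _; apply: exec_Seq; first exact: exec_Add.
  exact: exec_Sub.
have [||||t le e] := loop (reg s 0) (start i s).
- by rewrite reg_start_test //; lia.
- by rewrite reg_start_ctr.
- by rewrite reg_start //; lia.
- by rewrite reg_start //; lia.
exists (1 + (1 + t)).
  rewrite hornerD hornerM hornerD hornerX !hornerC /GRing.add /GRing.mul /=.
  have le2 : reg s 0 * ((cost b).[m]%R + 3) <= m * ((cost b).[m]%R + 3).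
    by rewrite leq_mul2r r0 orbT.
  suff: 1 + (1 + t) <= m * ((cost b).[m]%R + 3) + 3 by [].
  by lia.
by apply: exec_Seq; [exact: exec_Const | apply: exec_Seq e; exact: exec_Sub].
Qed.

(** Reduces a loop to an invariant indexed by the finished rounds; the counter equals that index
    because the body leaves it alone. *)
Lemma for_rule (I : nat -> state -> Prop) n i b s :
  reg s 0 = n -> reg s 1 = 1 -> wf (PFor i b) ->
  I 0 (start i s) ->
  (forall k s', k < n -> reg s' i = k -> I k s' -> I k.+1 (tick i (den b s'))) ->
  I n (den (PFor i b) s).
Proof.
move=> r0 r1 /= /and4P[lt_i wi wi1 wb] I0 IS; rewrite r0.
have: forall k, k <= n -> let s' := iter k (fun s => tick i (den b s)) (start i s) in
    [/\ reg s' i = k, reg s' 1 = 1 & I k s'].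
  elim=> [|k IHk] lt_k /=.
    split=> //; first by rewrite reg_start_ctr.
    by rewrite reg_start //; lia.
  have [ri r1' Ik] := IHk (ltnW lt_k); split; last exact: IS.
    have w1 : ~~ writes b 1 by exact: wf_writes.
    by rewrite reg_tick_ctr (den_reg _ wi) (den_reg _ w1) ri r1' addn1.
  by rewrite reg_tick ?den_reg ?wf_writes //; lia.
by case/(_ n (leqnn n)).
Qed.

(** * Exhaustive search as a program *)

Definition agree (c : prog) (s s' : state) :=
  [/\ forall r, ~~ writes c r -> reg s' r = reg s r,
      ram s' = ram s & out s' = out s].

Lemma agree_den c s : pure c -> agree c s (den c s).
Proof.
move=> pc; have [rE oE] := den_pure s pc.
by split=> // r wr; rewrite den_reg.
Qed.

Lemma agree_trans c s1 s2 s3 : agree c s1 s2 -> agree c s2 s3 -> agree c s1 s3.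
Proof.
move=> [r1 m1 o1] [r2 m2 o2]; split; rewrite ?m2 ?o2 // => r wr.
by rewrite r2 ?r1.
Qed.

Lemma agree_sub c c' s s' :
  (forall r, writes c r -> writes c' r) -> agree c s s' -> agree c' s s'.
Proof. by move=> sub [rE mE oE]; split=> // r wr; apply/rE/(contra _ wr)/sub. Qed.

Lemma agree_start i b s : agree (PFor i b) s (start i s).
Proof.
split; rewrite ?stateE // => r /=.
by rewrite !negb_or => /and3P[ri ri1 _]; rewrite reg_start.
Qed.

Lemma agree_tick i b s : pure b -> agree (PFor i b) s (tick i (den b s)).
Proof.
move=> pb; have [rE oE] := den_pure s pb; split; rewrite ?stateE // => r /=.
by rewrite !negb_or => /and3P[ri ri1 wr]; rewrite reg_tick ?den_reg.
Qed.

(** On success [f] is 1 and [r] holds an index accepted by [test], which answers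
    in [t]; otherwise [f] is 0. Register 7 is supposed to hold 0. *)
Definition search i t f r test :=
  PConst f 0 ;; PFor i (test ;; PIf t (PConst f 1 ;; PAdd r i 7) (PConst t 0)).

(** The test need only be right in states reached during the search, described by [agree]. The loop
    goes on after a hit and later hits overwrite earlier ones; which index is returned is left
    open. *)
Lemma search_spec i t f r test s n (Q : pred nat) :
  let c := search i t f r test in
  [&& wf c, pure test & ~~ writes c 7] ->
  [&& ~~ writes test f, ~~ writes test r, t != f, t != r & r != f] ->
  reg s 0 = n -> reg s 1 = 1 -> reg s 7 = 0 ->
  (forall s', agree c s s' -> reg s' i < n -> (reg (den test s') t != 0) = Q (reg s' i)) ->
  let s1 := den c s in
  (reg s1 f = 0 /\ forall k, k < n -> ~~ Q k) \/
  [/\ reg s1 f = 1, reg s1 r < n & Q (reg s1 r)].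
Proof.
move=> c /and3P[wc pt w7] /and5P[wtf wtr tf tr rf] r0 r1 r7 tQ.
pose b := test ;; PIf t (PConst f 1 ;; PAdd r i 7) (PConst t 0).
have [wc1 wc2] : 1 < f /\ wf (PFor i b) by case/andP: (wc).
have sb x : writes (PFor i b) x -> writes c x by rewrite /c /search /= => ->; rewrite orbT.
pose s0 := set_reg s f 0.
have ag0 : agree c s s0.
  split; rewrite ?stateE // => x; rewrite /c /search /= negb_or => /andP[xf _].
  by rewrite reg_set (negPf xf).
pose I k s' := agree c s s' /\ ((reg s' f = 0 /\ forall j, j < k -> ~~ Q j) \/
  [/\ reg s' f = 1, reg s' r < n & Q (reg s' r)]).
have pb : pure b by rewrite /= pt.
have [fi fi1 ri ri1] : [/\ f != i, f != i.+1, r != i & r != i.+1].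
  by case/and4P: wc2 => _ /= wi wi1 _; split; lia.
suff: I n (den (PFor i b) s0) by case.
apply: for_rule => //.
- by rewrite reg_set ltn_eqF //; lia.
- by rewrite reg_set ltn_eqF.
- split; first exact/(agree_trans ag0)/(agree_sub sb)/agree_start.
  by left; rewrite reg_start // reg_set eqxx.
move=> k s' lt_k rk [ag H]; split.
  exact/(agree_trans ag)/(agree_sub sb)/agree_tick.
rewrite !reg_tick //= (tQ s') ?rk //.
case: ifP => [Qk|/negbT nQ].
  right; rewrite !reg_set eqxx [f == r]eq_sym (negPf rf) eqxx.
  have wi : ~~ writes test i by case/and4P: wc2 => _ /=; rewrite negb_or => /andP[].
  have w7t : ~~ writes test 7.
    by move: w7; rewrite /c /search /= !negb_or => /andP[_ /and3P[_ _ /andP[]]].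
  have f7 : 7 == f = false by move: w7; rewrite /c /search /= !negb_or => /andP[/negPf].
  by rewrite eq_sym (negPf fi) f7 !den_reg // rk; have [-> //] := ag; rewrite r7 addn0.
rewrite !reg_set ![_ == t]eq_sym (negPf tf) (negPf tr) !den_reg //.
case: H => [[f0 nQj]|]; [left | by right].
by split=> // j; rewrite ltnS leq_eqVlt => /predU1P[->|/nQj].
Qed.

(** * The memory of the algorithm *)

Lemma denS a b s : den (a ;; b) s = den b (den a s).
Proof. by []. Qed.

Lemma reg_if x a b s r :
  reg (den (PIf x a b) s) r = if reg s x != 0 then reg (den a s) r else reg (den b s) r.
Proof. by move=> /=; case: ifP. Qed.

Lemma reg_const x k s : reg (den (PConst x k) s) x = k.
Proof. by rewrite /= reg_set eqxx. Qed.

Lemma reg_add x y z s : reg (den (PAdd x y z) s) x = reg s y + reg s z.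
Proof. by rewrite /= reg_set eqxx. Qed.

Lemma reg_sub x y z s : reg (den (PSub x y z) s) x = reg s y - reg s z.
Proof. by rewrite /= reg_set eqxx. Qed.

Lemma reg_fetch x y s : reg (den (PFetch x y) s) x = ram s (reg s y).
Proof. by rewrite /= reg_set eqxx. Qed.

Lemma ram_store x y s a :
  ram (den (PStore x y) s) a = if a == reg s x then reg s y else ram s a.
Proof. by rewrite /= ram_set_mem. Qed.

Lemma ram_print x s : ram (den (PPrint x) s) = ram s.
Proof. by rewrite /= emitE. Qed.

Lemma out_print x s : out (den (PPrint x) s) = rcons (out s) (reg s x).
Proof. by rewrite /= emitE. Qed.

Lemma out_den c s : pure c -> out (den c s) = out s.
Proof. by case/(den_pure s). Qed.

Lemma out_store x y s : out (den (PStore x y) s) = out s.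
Proof. by rewrite /= out_set_mem. Qed.

Lemma ram_den c s : pure c -> ram (den c s) = ram s.
Proof. by case/(den_pure s). Qed.

Lemma den_if x a b s :
  den (PIf x a b) s = if reg s x != 0 then den a s else den b s.
Proof. by []. Qed.

Opaque den.

(** Plain [rewrite] compares states up to conversion and would run the programs. *)
Ltac subst_eq e :=
  match type of e with
  | ?t = _ => pattern t; match goal with |- ?P _ => refine (@eq_ind_r _ _ P _ _ e) end;
              cbv beta
  end.

Ltac dens := repeat
  match goal with |- context [den (PSeq ?a ?b) ?s] => subst_eq (denS a b s) end.

(** Evaluates [reg] and [ram] of the state after a program, stopping at the
    registers written by a subprogram. *)
Ltac regs := repeat first
  [ match goal with |- context [reg (den ?c ?s) ?r] =>
      subst_eq (@den_reg c s r ltac:(vm_compute; reflexivity)) end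
  | match goal with |- context [reg (tick ?i ?s) ?r] =>
      subst_eq (@reg_tick i s r ltac:(vm_compute; reflexivity) ltac:(vm_compute; reflexivity)) end
  | match goal with |- context [reg (start ?i ?s) ?r] =>
      subst_eq (@reg_start i s r ltac:(vm_compute; reflexivity) ltac:(vm_compute; reflexivity)) end
  | match goal with |- context [ram (den ?c ?s)] =>
      subst_eq (@ram_den c s ltac:(vm_compute; reflexivity)) end
  | match goal with
    | |- context [ram (tick ?i ?s)] => subst_eq (ram_tick i s)
    | |- context [ram (start ?i ?s)] => subst_eq (ram_start i s)
    | |- context [den (PSeq ?a ?b) ?s] => subst_eq (denS a b s)
    | |- context [reg (den (PIf ?x ?a ?b) ?s) ?r] => subst_eq (reg_if x a b s r)
    | |- context [reg (den (PConst ?x ?k) ?s) ?x] => subst_eq (reg_const x k s)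
    | |- context [reg (den (PAdd ?x ?y ?z) ?s) ?x] => subst_eq (reg_add x y z s)
    | |- context [reg (den (PSub ?x ?y ?z) ?s) ?x] => subst_eq (reg_sub x y z s)
    | |- context [reg (den (PFetch ?x ?y) ?s) ?x] => subst_eq (reg_fetch x y s)
    | |- context [ram (den (PStore ?x ?y) ?s) ?a] => subst_eq (ram_store x y s a)
    end ].

(** * Adjacency, membership and extension as programs *)

Lemma nth_allpairs (S T R : Type) (f : S -> T -> R) s t x y r i j :
  i < size s -> j < size t ->
  nth r [seq f u v | u <- s, v <- t] (i * size t + j) = f (nth x s i) (nth y t j).
Proof.
move=> + lt_j; elim: s i => // u s IH [|i] lt_i; rewrite allpairs_cons nth_cat size_map.
  by rewrite lt_j (nth_map y).
by rewrite ltnNge mulSn -addnA leq_addr addKn; apply: IH.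
Qed.

Definition core_low c := all (fun r => ~~ writes c r) [:: 0; 1; 3; 4; 5; 7].
Definition low c := core_low c && ~~ writes c 2.

(** Inputs in registers 20 and 21, answer in register 25. *)
Definition mul := PConst 24 0 ;; PFor 22 (PAdd 24 24 20).
Definition adj :=
  mul ;; PAdd 24 24 21 ;; PAdd 24 24 0 ;; PAdd 24 24 1 ;; PFetch 25 24.

(** Input in register 26, answer in register 29. *)
Definition in_path_test :=
  PSub 31 2 27 ;;
  PIf 31 (PAdd 32 3 27 ;; PFetch 33 32 ;; PSub 34 33 26 ;; PSub 35 26 33 ;;
          PAdd 34 34 35 ;; PIf 34 (PConst 31 0) (PConst 31 1))
         (PConst 31 0).
Definition in_path := search 27 31 29 30 in_path_test.

Definition last_vertex := PSub 40 2 1 ;; PAdd 40 3 40 ;; PFetch 20 40.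
Definition append := PAdd 40 3 2 ;; PStore 40 45 ;; PAdd 2 2 1.
(** The test finds the last vertex in register 20 and the candidate in register 41. [PConst 43 0] in
    the last branch stands for doing nothing. *)
Definition grow test :=
  last_vertex ;; search 41 43 44 45 test ;; PIf 44 append (PConst 43 0).

Definition ext_test :=
  PAdd 21 41 7 ;; adj ;; PAdd 46 41 1 ;; PFetch 46 46 ;; PAdd 26 41 7 ;; in_path ;;
  PIf 25 (PIf 46 (PConst 43 0) (PIf 29 (PConst 43 0) (PConst 43 1))) (PConst 43 0).
Definition ext := grow ext_test.

(** Truncated subtraction makes register 49 nonzero exactly when the candidate has a smaller label
    than the last vertex. *)
Definition desc_test :=
  PAdd 21 41 7 ;; adj ;; PAdd 47 5 20 ;; PFetch 47 47 ;; PAdd 48 5 41 ;; PFetch 48 48 ;;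
  PSub 49 47 48 ;;
  PIf 25 (PIf 48 (PIf 49 (PConst 43 1) (PConst 43 0)) (PConst 43 0)) (PConst 43 0).
Definition desc := grow desc_test.

(** * Memory invariants and correctness of the subprograms *)

Section Memory.
Variables (n : nat) (G : sgraph 'I_n) (B : {set 'I_n}).
Implicit Types (s : state) (p q : seq 'I_n) (lab : 'I_n -> nat) (u v : 'I_n).

Local Notation simple := (simple_path G).
Local Notation base := (1 + n + n * n).

Lemma size_encode : size (encode G B) = base.
Proof. by rewrite /= size_cat size_map size_allpairs size_enum_ord. Qed.

Lemma encode_B v : nth 0 (encode G B) v.+1 = (v \in B).
Proof.
rewrite /= nth_cat size_map size_enum_ord ltn_ord (nth_map v) ?size_enum_ord //.
by rewrite nth_ord_enum.
Qed.

Lemma encode_G u v : nth 0 (encode G B) (1 + n + (u * n + v)) = G u v.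
Proof.
rewrite add1n addSn /= nth_cat size_map size_enum_ord ltnNge leq_addr /= addKn.
have := @nth_allpairs _ _ _ (fun u v => nat_of_bool (G u v)) (enum 'I_n) (enum 'I_n) u v 0 u v.
by rewrite size_enum_ord => -> //; rewrite !nth_ord_enum.
Qed.

(** The input is followed by the path, a scratch copy of it, and the labels, [n]
    cells each.  Register 2 holds the number of vertices of the path. *)
Record core s lab : Prop := Core {
  core0 : reg s 0 = n;
  core1 : reg s 1 = 1;
  core3 : reg s 3 = base;
  core4 : reg s 4 = base + n;
  core5 : reg s 5 = base + n + n;
  core7 : reg s 7 = 0;
  core_in : forall a, a < base -> ram s a = nth 0 (encode G B) a;
  core_lab : forall v, ram s (base + n + n + v) = lab v;
  core_out : out s = [::] }.

Definition stores s p :=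
  reg s 2 = size p /\ forall k, k < size p -> ram s (base + k) = nth 0 [seq val v | v <- p] k.

Definition inv s p lab := [/\ core s lab, stores s p & simple p].

Lemma core_agree c s s' lab : core_low c -> agree c s s' -> core s lab -> core s' lab.
Proof.
move=> /and5P[w0 w1 w3 w4 /and3P[w5 w7 _]] [rE mE oE] [*].
by split; rewrite ?mE ?oE ?rE.
Qed.

Lemma inv_agree c s s' p lab : low c -> agree c s s' -> inv s p lab -> inv s' p lab.
Proof.
move=> /andP[lc w2] ag [C [r2 Hp] Sp]; split=> //; first exact: core_agree ag C.
have [rE mE _] := ag.
by split; rewrite ?mE ?rE.
Qed.

Lemma core_den c s lab : pure c && core_low c -> core s lab -> core (den c s) lab.
Proof. by case/andP=> pc lc; apply: core_agree lc (agree_den s pc). Qed.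

Lemma inv_den c s p lab : pure c && low c -> inv s p lab -> inv (den c s) p lab.
Proof. by case/andP=> pc lc; apply: inv_agree lc (agree_den s pc). Qed.

Lemma agree_tick_self i s : agree (PFor i (PConst i 0)) s (tick i s).
Proof.
split; rewrite ?stateE // => r /=; rewrite !negb_or => /and3P[ri ri1 _].
by rewrite reg_tick.
Qed.

Lemma inv_tick i s p lab : 7 < i -> inv s p lab -> inv (tick i s) p lab.
Proof. by move=> lt_i; apply: inv_agree (agree_tick_self i s); rewrite /low /core_low /=; lia. Qed.

Lemma inv_start i s p lab : 7 < i -> inv s p lab -> inv (start i s) p lab.
Proof.
by move=> lt_i; apply: inv_agree (agree_start i (PConst i 0) s); rewrite /low /core_low /=; lia.
Qed.

Lemma core_tick i s lab : 7 < i -> core s lab -> core (tick i s) lab.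
Proof. by move=> lt_i; apply: core_agree (agree_tick_self i s); rewrite /low /core_low /=; lia. Qed.

Lemma core_start i s lab : 7 < i -> core s lab -> core (start i s) lab.
Proof.
by move=> lt_i; apply: core_agree (agree_start i (PConst i 0) s); rewrite /low /core_low /=; lia.
Qed.

Lemma core_store x y s lab :
  base <= reg s x < base + n + n -> core s lab -> core (den (PStore x y) s) lab.
Proof.
move=> /andP[le_a lt_a] C; split; rewrite ?den_reg ?out_store //; try by case: C.
  by move=> b lt_b; rewrite ram_store (core_in C) // ltn_eqF //; lia.
by move=> u; rewrite ram_store (core_lab C) gtn_eqF //; lia.
Qed.

Lemma inv_size s p lab : inv s p lab -> size p <= n.
Proof. by case=> _ _ /simple_size; rewrite card_ord. Qed.

Lemma inv_store_tmp x y s p lab :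
  base + n <= reg s x < base + n + n -> inv s p lab -> inv (den (PStore x y) s) p lab.
Proof.
move=> /andP[le_a lt_a] I; have le_p := inv_size I; have [C [r2 Hp] Sp] := I.
split=> //; first by apply: core_store C; lia.
split; first by rewrite den_reg.
by move=> k lt_k; rewrite ram_store Hp // ltn_eqF //; lia.
Qed.

Lemma core_B s lab v : core s lab -> ram s (v + 1) = (v \in B).
Proof.
by move=> C; rewrite (core_in C) ?addn1 ?encode_B //; have := ltn_ord v; lia.
Qed.

(** The matrix is preceded by the cell holding [n] and the [n] cells for [B], hence the offset
    [n + 1]. *)
Lemma core_G s lab u v : core s lab -> ram s (n * u + v + n + 1) = G u v.
Proof.
move=> C; have lt_u := ltn_ord u; have lt_v := ltn_ord v.
have lt_uv : u * n + v < n * n.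
  by apply: (@leq_trans (u.+1 * n)); rewrite ?leq_mul2r ?lt_u ?orbT // mulSn; lia.
have -> : n * u + v + n + 1 = 1 + n + (u * n + v) by lia.
by rewrite (core_in C) ?encode_G //; lia.
Qed.

Lemma mul_spec s : reg s 0 = n -> reg s 1 = 1 -> reg (den mul s) 24 = n * reg s 20.
Proof.
move=> r0 r1; rewrite /mul denS.
suff: reg (den (PFor 22 (PAdd 24 24 20)) (den (PConst 24 0) s)) 24 = n * reg s 20 /\
  reg (den (PFor 22 (PAdd 24 24 20)) (den (PConst 24 0) s)) 20 = reg s 20 by case.
apply: (for_rule (I := fun k s' => reg s' 24 = k * reg s 20 /\ reg s' 20 = reg s 20)) => //.
by move=> k s' _ _ [r24 r20]; split; regs => //; rewrite r24 r20 mulSn addnC.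
Qed.

Opaque mul.

Lemma adj_spec s lab u v :
  core s lab -> reg s 20 = u -> reg s 21 = v -> reg (den adj s) 25 = G u v.
Proof.
move=> C r20 r21; rewrite /adj; regs.
by rewrite mul_spec ?(core0 C) ?(core1 C) // r20 r21 (core_G _ _ C).
Qed.

Lemma in_path_spec s p lab v :
  inv s p lab -> reg s 26 = v -> reg (den in_path s) 29 = (v \in p).
Proof.
move=> I r26; have [C [r2 Hp] Sp] := I.
pose Q k := (k < size p) && (nth 0 [seq val u | u <- p] k == v).
have := @search_spec 27 31 29 30 in_path_test s n Q isT isT (core0 C) (core1 C) (core7 C).
case=> [s' ag lt27||[r29 _ /andP[lt_k /eqP Ek]]].
- have [rE _ _] := ag; have r26' : reg s' 26 = v by rewrite rE.
  have [C' [r2' Hp'] _] : inv s' p lab by apply: inv_agree ag I.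
  rewrite /in_path_test; regs.
  rewrite r2' r26' (core3 C') subn_eq0 -ltnNge /Q; case: ltnP => //= lt_k.
  (* The two truncated differences sum to 0 only when the vertices are equal. *)
  by rewrite Hp' // addn_eq0 !subn_eq0 -eqn_leq; case: (nth _ _ _ == _).
- case=> r29 nQ; rewrite -/in_path in r29; rewrite r29.
  case: (boolP (v \in p)) => // v_p.
  have := nQ (index v p); rewrite /Q index_mem v_p (nth_map v) ?index_mem // nth_index // eqxx.
  have lt_v : index v p < n.
    apply: (@leq_trans (size p)); rewrite ?index_mem //.
    by have := simple_size Sp; rewrite card_ord.
  by move/(_ lt_v)/negP.
rewrite -/in_path in r29; rewrite r29; rewrite (nth_map v) // in Ek.
by rewrite -(val_inj Ek) mem_nth.
Qed.

Opaque adj in_path.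

Lemma last_vertex_spec s x t lab :
  inv s (x :: t) lab -> reg (den last_vertex s) 20 = last x t.
Proof.
move=> [C [r2 Hp] _]; rewrite /last_vertex; regs.
by rewrite (core3 C) (core1 C) r2 subn1 Hp // (last_nth x) (nth_map x).
Qed.

Lemma append_spec s p v lab :
  inv s p lab -> reg s 45 = v -> simple (rcons p v) -> inv (den append s) (rcons p v) lab.
Proof.
move=> [C [r2 Hp] Sp] r45 Sv.
have lt_p : size p < n by have := simple_size Sv; rewrite size_rcons card_ord.
rewrite /append; dens; split=> //.
  apply: core_den; first by vm_compute.
  by apply: core_store; [regs; rewrite (core3 C) r2; lia | apply: core_den].
split; first by regs; rewrite r2 (core1 C) addn1 size_rcons.
move=> k; rewrite size_rcons ltnS => le_k; regs.
rewrite (core3 C) r2 r45 eqn_add2l map_rcons nth_rcons size_map.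
case: eqVneq => [->|nek]; first by rewrite ltnn.
have lt_k : k < size p by lia.
rewrite lt_k; exact: Hp.
Qed.

Opaque last_vertex append.

Lemma grow_spec test s p lab x t (Q : pred 'I_n) :
  let c := search 41 43 44 45 test in
  [&& wf c, pure test, low c & ~~ writes c 20] ->
  ~~ writes test 44 && ~~ writes test 45 ->
  inv s p lab -> p = x :: t ->
  (forall s' v, inv s' p lab -> reg s' 20 = last x t -> reg s' 41 = v ->
     (reg (den test s') 43 != 0) = Q v) ->
  (forall v, Q v -> simple (rcons p v)) ->
  exists2 q, (exists2 v, Q v & q = rcons p v) \/ (q = p /\ forall v, ~~ Q v)
    & inv (den (grow test) s) q lab.
Proof.
move=> c /and4P[wc pt lc w20] /andP[w44 w45] I def_p tQ sQ.
rewrite /grow -/c; dens; set s1 := den last_vertex s.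
have I1 : inv s1 p lab by apply: inv_den I.
have r20 : reg s1 20 = last x t by apply: last_vertex_spec; rewrite -def_p; exact: I.
(* A search ranges over numbers, so the predicate on vertices is extended by [false]. *)
pose Q' k := if insub k is Some v then Q v else false.
have pc : pure c by rewrite /c /search /= pt.
have I2 : inv (den c s1) p lab by apply: inv_den I1; rewrite pc lc.
have QQ v : Q' v = Q v.
  by rewrite /Q'; have -> : insub (nat_of_ord v) = Some v by exact: valK.
have [C1 _ _] := I1; have w7 : ~~ writes c 7 by case/andP: lc => /and5P[_ _ _ _ /and3P[]].
have H1 : [&& wf c, pure test & ~~ writes c 7] by rewrite wc pt.
have H2 : [&& ~~ writes test 44, ~~ writes test 45, 43 != 44, 43 != 45 & 45 != 44].
  by rewrite w44 w45.
case: (@search_spec 41 43 44 45 test s1 n Q' H1 H2 (core0 C1) (core1 C1) (core7 C1)).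
- move=> s' ag lt_k; have := tQ s' (Ordinal lt_k); rewrite -QQ /=; apply=> //.
    exact: inv_agree ag I1.
  by have [rE _ _] := ag; rewrite rE.
- move=> [r44 nQ]; exists p; first by right; split=> // v; rewrite -QQ nQ.
  by rewrite den_if r44; apply: inv_den I2.
case=> r44 lt_v Qv; have {}Qv : Q (Ordinal lt_v) by rewrite -QQ.
exists (rcons p (Ordinal lt_v)); first by left; exists (Ordinal lt_v).
by rewrite den_if r44; apply: append_spec I2 _ _ => //; apply: sQ.
Qed.

End Memory.

Ltac keep := repeat first
  [ assumption
  | match goal with
    | |- inv _ _ (tick _ _) _ _ => apply: inv_tick; [by [] |]
    | |- inv _ _ (start _ _) _ _ => apply: inv_start; [by [] |]
    | |- inv _ _ (den _ _) _ _ => apply: inv_den; [by vm_compute |]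
    | |- core _ _ (tick _ _) _ => apply: core_tick; [by [] |]
    | |- core _ _ (start _ _) _ => apply: core_start; [by [] |]
    | |- core _ _ (den _ _) _ => apply: core_den; [by vm_compute |]
    end ].

(** * Moves on the stored path *)

(** Register 50 holds the index from which on the path is reversed. *)
Definition copy_tmp :=
  PFor 51 (PAdd 53 3 51 ;; PFetch 54 53 ;; PAdd 53 4 51 ;; PStore 53 54).
(** Reads from the scratch copy, since a reversal in place would overwrite cells still to be read;
    cells before the index in register 50 stay untouched. *)
Definition copy_back :=
  PFor 55 (PSub 57 2 55 ;; PAdd 58 55 1 ;; PSub 58 58 50 ;;
    PIf 57 (PIf 58 (PAdd 57 50 57 ;; PSub 57 57 1 ;; PAdd 57 4 57 ;; PFetch 59 57 ;;
                    PAdd 58 3 55 ;; PStore 58 59)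
                   (PConst 57 0))
           (PConst 57 0)).
Definition rev_from := copy_tmp ;; copy_back.

Definition ends := PFetch 20 3 ;; PSub 79 2 1 ;; PAdd 79 3 79 ;; PFetch 21 79.
Definition adj_first := ends ;; PFetch 21 77 ;; adj.
Definition adj_last := ends ;; PFetch 20 77 ;; adj.
Definition cyc_test :=
  PAdd 75 70 1 ;; PSub 76 2 75 ;;
  PIf 76 (PAdd 77 3 75 ;; adj_first ;; PAdd 78 25 7 ;; PAdd 77 3 70 ;; adj_last ;;
          PIf 78 (PIf 25 (PConst 72 1) (PConst 72 0)) (PConst 72 0))
         (PConst 72 0).
Definition cyc :=
  search 70 72 73 74 cyc_test ;; PIf 73 (PAdd 50 74 1 ;; rev_from) (PConst 72 0).
Definition rot_if_closed :=
  ends ;; adj ;;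
  PIf 25 (PConst 50 1 ;; rev_from ;; PConst 50 0 ;; rev_from) (PConst 72 0).
Definition gext := PFor 80 ext.
Definition reversal := PConst 50 0 ;; rev_from.
Definition turn := PFor 82 (gext ;; rot_if_closed).
Definition improve := gext ;; reversal ;; gext ;; cyc ;; turn.

Section Moves.
Variables (n : nat) (G : sgraph 'I_n) (B : {set 'I_n}).
Implicit Types (s : state) (p q : seq 'I_n) (lab : 'I_n -> nat) (u v : 'I_n).

Local Notation simple := (simple_path G).
Local Notation base := (1 + n + n * n).
Local Notation core := (core G B).
Local Notation inv := (inv G B).

Lemma ext_spec s p lab :
  inv s p lab -> exists2 q, ext_rel G B p q & inv (den ext s) q lab.
Proof.
move=> I; have [_ _ Sp] := I; case def_p: p => [|x t]; first by rewrite def_p in Sp.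
rewrite -def_p; apply: (@grow_spec n G B ext_test s p lab x t (extends G B p)) => //.
- move=> s' v I' r20 r41; rewrite /ext_test; regs.
  have [C' _ _] := I'.
  rewrite (adj_spec (G := G) (B := B) (lab := lab) (u := last x t) (v := v)); last 3 first.
  + by keep.
  + by regs.
  + by regs; rewrite r41 (core7 C') addn0.
  rewrite (in_path_spec (G := G) (B := B) (p := p) (lab := lab) (v := v)); last 2 first.
  + by keep.
  + by regs; rewrite r41 (core7 C') addn0.
  rewrite r41 (core1 C') (core_B _ C') /extends def_p.
  by case: (G _ _); case: (v \in B); case: (v \in _).
- by move=> v; apply: simple_rcons.
Qed.

(** The last vertex has the least label on the path, so a vertex of smaller label is new and the
    path stays simple. *)
Lemma desc_spec s p lab x t :
  inv s p lab -> p = x :: t -> (forall u, u \in p -> lab (last x t) <= lab u) ->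
  let Q v := [&& G (last x t) v, 0 < lab v & lab v < lab (last x t)] in
  exists2 q, (exists2 v, Q v & q = rcons p v) \/ (q = p /\ forall v, ~~ Q v)
    & inv (den desc s) q lab.
Proof.
move=> I def_p lab_p Q; apply: (grow_spec _ _ I def_p).
- by vm_compute.
- by vm_compute.
- move=> s' v I' r20 r41; rewrite /desc_test; regs.
  have [C' _ _] := I'.
  rewrite (adj_spec (G := G) (B := B) (lab := lab) (u := last x t) (v := v)); last 3 first.
  + by keep.
  + by regs.
  + by regs; rewrite r41 (core7 C') addn0.
  rewrite r41 r20 (core5 C') !(core_lab C') /Q subn_eq0 -ltnNge.
  by case: (G _ _) => //=; case: posnP => //= _; case: ltnP.
move=> v /and3P[Gv _ lt_v]; have [_ _] := I; rewrite def_p.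
move=> /andP[xt Us]; rewrite rcons_cons; apply/andP; split; first by rewrite rcons_path xt.
rewrite -rcons_cons rcons_uniq Us andbT -def_p; apply/negP=> /lab_p.
by rewrite leqNgt lt_v.
Qed.


Opaque ext desc.

(** * Reversal of a suffix in memory *)

Lemma nth_rev_suffix (x0 : nat) j r k : j <= size r -> k < size r ->
  nth x0 (rev_suffix j r) k = if k < j then nth x0 r k else nth x0 r (j + (size r - k) - 1).
Proof.
move=> le_j lt_k; rewrite /rev_suffix nth_cat size_takel //; case: ltnP => jk.
  by rewrite nth_take.
by rewrite nth_rev size_drop ?nth_drop; [congr nth; lia | lia].
Qed.

Lemma rev_from_spec s p lab j :
  inv s p lab -> reg s 50 = j -> j <= size p -> simple (rev_suffix j p) ->
  inv (den rev_from s) (rev_suffix j p) lab.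
Proof.
move=> I r50 le_j Sq; rewrite /rev_from; dens; set s1 := den copy_tmp s.
pose P := [seq val v | v <- p]; have szP : size P = size p by rewrite size_map.
have [I1 r50' H1] : [/\ inv s1 p lab, reg s1 50 = j &
    forall i, i < n -> i < size p -> ram s1 (base + n + i) = nth 0 P i].
  apply: (for_rule (I := fun k s' => [/\ inv s' p lab, reg s' 50 = j &
    forall i, i < k -> i < size p -> ram s' (base + n + i) = nth 0 P i])) => //.
  - by have [/core0] := I.
  - by have [/core1] := I.
  - by split; [keep | regs |].
  move=> k s' lt_k rk [I' r50' H']; have [C' [r2 Hp] _] := I'.
  split; [| by regs |].
  - by dens; keep; apply: inv_store_tmp; [regs; rewrite rk (core4 C'); lia | keep].
  move=> i; rewrite ltnS => le_i lt_i; regs; rewrite rk (core3 C') (core4 C') eqn_add2l.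
  case: eqVneq => [ik|ne_i]; first by rewrite -ik Hp.
  by apply: H'; lia.
pose q := rev_suffix j p.
have Pq : [seq val v | v <- q] = rev_suffix j P.
  by rewrite /q /rev_suffix map_cat map_rev map_take map_drop.
have nq k : k < size p -> nth 0 (rev_suffix j P) k =
    if k < j then nth 0 P k else nth 0 P (j + (size p - k) - 1).
  by move=> lt_k; have := @nth_rev_suffix 0 j P k; rewrite szP; apply.
have le_n := inv_size I; have [C1 [r2 Hp] _] := I1.
have: [/\ core (den copy_back s1) lab, reg (den copy_back s1) 2 = size p &
    forall i, i < size p -> ram (den copy_back s1) (base + i) =
      nth 0 (if i < n then rev_suffix j P else P) i].
  (* The first [k] cells already hold the new path, the others still the old one, and the scratch
     copy is intact. *)
  pose J k s' := [/\ core s' lab, reg s' 2 = size p, reg s' 50 = j,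
    (forall i, i < size p -> ram s' (base + n + i) = nth 0 P i) &
    forall i, i < size p -> ram s' (base + i) = nth 0 (if i < k then rev_suffix j P else P) i].
  suff: J n (den copy_back s1) by case.
  apply: for_rule.
  - exact: core0 C1.
  - exact: core1 C1.
  - by vm_compute.
  - split; try by regs.
    + by keep.
    + by move=> i lt_i; regs; apply: H1 => //; lia.
  move=> k s' lt_k rk [C' r2' r50'' Ht Hb].
  dens; rewrite den_if; regs; rewrite r2' rk subn_eq0 -ltnNge.
  case: ltnP => [lt_kp|le_pk]; last first.
    split; try by regs.
    + by keep.
    + by move=> i lt_i; regs; rewrite Hb //; have -> : (i < k.+1) = (i < k) by lia.
  rewrite den_if; regs; rewrite rk r50'' (core1 C') addn1 subn_eq0 -ltnNge ltnS.
  case: leqP => [le_jk|lt_kj]; last first.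
    split; try by regs.
    + by keep.
    + move=> i lt_i; regs; have -> : (i < k.+1) = (i == k) || (i < k) by lia.
      by rewrite Hb //; case: eqVneq => [->|//]; rewrite ltnn nq // lt_kj.
  dens; split; try by regs.
  + keep; apply: core_store; last by keep.
    by regs; rewrite rk (core3 C'); lia.
  + move=> i lt_i; regs; rewrite rk (core3 C') gtn_eqF; last by lia.
    exact: Ht.
  + move=> i lt_i; regs; rewrite rk r2' r50'' (core1 C') (core3 C') (core4 C') eqn_add2l.
    have -> : (i < k.+1) = (i == k) || (i < k) by lia.
    case: eqVneq => [->|ne_i] /=; last exact: Hb.
    by rewrite nq // ltnNge le_jk /= -addnBA ?Ht //; lia.
case=> C2 r2'' H2; split=> //; split.
  by rewrite r2'' (perm_size (perm_rev_suffix _ _)).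
move=> k; rewrite (perm_size (perm_rev_suffix _ _)) => lt_k.
by rewrite H2 // (leq_trans lt_k le_n) -Pq.
Qed.

Opaque rev_from.

(** * Programs implementing the moves *)

Definition implements c (R : seq 'I_n -> seq 'I_n -> Prop) :=
  forall s p lab, inv s p lab -> exists2 q, R p q & inv (den c s) q lab.

Lemma implements_seq a b R S :
  implements a R -> implements b S -> implements (a ;; b) (rcomp R S).
Proof.
move=> iR iS s p lab /iR[r Rpr /iS[q Srq I]]; exists q; first by exists r.
by dens.
Qed.

Lemma implements_for i b R :
  7 < i -> wf (PFor i b) -> implements b R -> implements (PFor i b) (riter R n).
Proof.
move=> lt_i wb iR s p lab I; have [C _ _] := I.
apply: (for_rule (I := fun k s' => exists2 q, riter R k p q & inv s' q lab)) => //.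
- exact: core0 C.
- exact: core1 C.
- by exists p => //; apply: inv_start.
move=> k s' _ _ [r Rr /iR[q Rrq I']]; exists q; first by exists r.
exact: inv_tick.
Qed.

Lemma gext_spec : implements gext (gext_rel G B).
Proof.
rewrite /gext_rel card_ord; apply: implements_for => // s p lab.
exact: ext_spec.
Qed.

Lemma reversal_spec : implements reversal (@rev_rel _).
Proof.
move=> s p lab I; exists (rev p) => //; rewrite /reversal; dens.
have -> : rev p = rev_suffix 0 p by rewrite /rev_suffix take0 drop0.
have [_ _ Sp] := I; apply: rev_from_spec; [by keep | by regs | by [] |].
by rewrite /rev_suffix take0 drop0; apply: simple_rev.
Qed.

Lemma ends_spec s p lab x t :
  inv s p lab -> p = x :: t ->
  reg (den ends s) 20 = x /\ reg (den ends s) 21 = last x t.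
Proof.
move=> [C [r2 Hp] _] def_p; rewrite def_p in r2 Hp.
have C0 := Hp 0 isT; rewrite addn0 in C0.
rewrite /ends; split; regs; rewrite (core3 C) ?C0 // (core1 C) r2 subn1 Hp //.
by rewrite (last_nth x) (nth_map x).
Qed.

Opaque ends.

Lemma adj_ends_spec s p lab x t k :
  inv s p lab -> p = x :: t -> k < size p -> reg s 77 = base + k ->
  reg (den adj_first s) 25 = G x (nth x p k) /\
  reg (den adj_last s) 25 = G (nth x p k) (last x t).
Proof.
move=> I def_p lt_k r77; have [C [_ Hp] _] := I; have [e1 e2] := ends_spec I def_p.
have pk : ram s (base + k) = nth x p k by rewrite Hp // (nth_map x).
split; rewrite /adj_first /adj_last; dens; apply: (@adj_spec n G B _ lab).
- by keep.
- by regs.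
- by regs; rewrite r77.
- by keep.
- by regs; rewrite r77.
- by regs.
Qed.

Opaque adj_first adj_last.

Lemma cyc_spec : implements cyc (cyc_rel G).
Proof.
move=> s p lab I; have [C _ Sp] := I; case def_p: p => [|x t]; first by rewrite def_p in Sp.
rewrite -def_p /cyc; dens.
have test s' : agree (search 70 72 73 74 cyc_test) s s' -> reg s' 70 < n ->
    (reg (den cyc_test s') 72 != 0) = crosses G p (reg s' 70).
  move=> ag _; set i := reg s' 70.
  have I' : inv s' p lab by apply: inv_agree ag I.
  have [C' [r2 Hp] _] := I'; rewrite /cyc_test; regs.
  rewrite -/i r2 (core1 C') (core7 C') addn0 addn1 subn_eq0 -ltnNge.
  rewrite def_p /= ltnS; case: ltnP => //= lt_i.
  have [lt_i1 lt_i'] : i.+1 < size p /\ i < size p by rewrite def_p /= !ltnS (ltnW lt_i).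
  rewrite (proj1 (adj_ends_spec (lab := lab) _ def_p lt_i1 _)); last 2 first.
  + by keep.
  + by regs; rewrite -/i (core1 C') (core3 C') addn1.
  rewrite (proj2 (adj_ends_spec (lab := lab) _ def_p lt_i' _)); last 2 first.
  + by keep.
  + by regs; rewrite (core3 C').
  by rewrite def_p /=; case: (G x _); case: (G _ _).
case: (@search_spec 70 72 73 74 cyc_test s n (crosses G p) isT isT
         (core0 C) (core1 C) (core7 C) test).
- case=> r73 nQ; exists p; last by rewrite den_if r73 /=; keep.
  (* The search covers indices below [n] only, but a crossing index is smaller than the size of the
     path. *)
  right; split=> // i; apply/negP=> Ci.
  have lt_i : i < n.
    have := simple_size Sp; rewrite card_ord; apply: leq_trans.
    by case: (p) Ci => //= y r /andP[] /ltnW.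
  by have := nQ i lt_i; rewrite Ci.
case=> r73 lt_i Ci; set s1 := den _ s in r73 lt_i Ci *; set i := reg s1 74 in lt_i Ci.
have R : cyc_rel G p (rev_suffix i.+1 p) by left; exists i.
exists (rev_suffix i.+1 p) => //; rewrite den_if r73 /=; dens.
have I1 : inv s1 p lab by rewrite /s1; keep.
have [C1 _ _] := I1.
apply: rev_from_spec; first by keep.
- by regs; rewrite -/i (core1 C1) addn1.
- by case: (p) Ci => //= y r /andP[] /ltnW.
by case: (grows_cyc B Sp R).
Qed.

Lemma rot_spec : implements rot_if_closed (rot_rel G).
Proof.
move=> s p lab I; have [C _ Sp] := I; case def_p: p => [|x t]; first by rewrite def_p in Sp.
rewrite -def_p; exists (rot_step G p) => //; rewrite /rot_if_closed; dens.
have I1 : inv (den adj (den ends s)) p lab by keep.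
rewrite den_if (@adj_spec n G B _ lab x (last x t)); last 3 first.
- by keep.
- exact: (proj1 (ends_spec I def_p)).
- exact: (proj2 (ends_spec I def_p)).
have cp : closed_path G p = G x (last x t) by rewrite def_p /= edge_sym.
have := rot_step_simple Sp; rewrite /rot_step cp.
case: (G x _) => /= S'; last by keep.
have e1 : rev_suffix 1 p = x :: rev t by rewrite def_p /rev_suffix /= drop0 take0.
have e2 : rot 1 p = rev_suffix 0 (rev_suffix 1 p).
  by rewrite e1 def_p /rev_suffix take0 drop0 /= rev_cons revK rot1_cons.
(* The invariant requires the intermediate sequence to be simple as well; it is the reversal of the
   rotated path. *)
have S1 : simple (rev_suffix 1 p).
  rewrite -[rev_suffix 1 p]revK; apply: simple_rev; move: S'.
  by rewrite e2 {1}/rev_suffix take0 drop0.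
dens; rewrite e2; apply: rev_from_spec => //.
- keep; apply: rev_from_spec; [by keep | by regs | by rewrite def_p | exact: S1].
by rewrite -e2.
Qed.

Opaque gext reversal cyc rot_if_closed.

Lemma turn_spec : implements turn (turn_rel G B).
Proof.
rewrite /turn_rel card_ord; apply: implements_for; [by [] | by vm_compute |].
exact: implements_seq gext_spec rot_spec.
Qed.

Opaque turn.

Lemma improve_spec : implements improve (improve_rel G B).
Proof.
apply: implements_seq gext_spec _; apply: implements_seq reversal_spec _.
apply: implements_seq gext_spec _; exact: implements_seq cyc_spec turn_spec.
Qed.

End Moves.

Opaque improve.

(** * Labels and the main program *)

(** Register 6 holds the largest label, register 8 the vertex labelled first.
    With [avoid], the labels spread in [G - B] only. *)
Definition label_test avoid :=
  PAdd 20 64 7 ;; PAdd 21 60 7 ;; adj ;; PAdd 69 5 64 ;; PFetch 69 69 ;;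
  PAdd 70 60 1 ;; PFetch 70 70 ;;
  PIf 25 (PIf 69 (if avoid then PIf 70 (PConst 66 0) (PConst 66 1) else PConst 66 1)
                 (PConst 66 0))
         (PConst 66 0).
Definition label_vertex avoid :=
  PAdd 62 5 60 ;; PFetch 63 62 ;;
  PIf 63 (PConst 63 0)
         (search 64 66 67 68 (label_test avoid) ;;
          PIf 67 (PAdd 6 6 1 ;; PStore 62 6) (PConst 66 0)).
Definition label_round avoid := PFor 60 (label_vertex avoid).
Definition labels avoid := PFor 90 (label_round avoid).

Definition layout :=
  PConst 3 0 ;; PFor 16 (PAdd 3 3 0) ;; PAdd 3 3 0 ;; PAdd 3 3 1 ;;
  PAdd 4 3 0 ;; PAdd 5 4 0.
Definition start_test :=
  PAdd 15 10 1 ;; PFetch 15 15 ;; PIf 15 (PConst 12 0) (PConst 12 1).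
(** If [B] contains all vertices, vertex 0 is taken. The stored one-vertex path keeps the invariant
    valid during the labelling; [restart] replaces it. *)
Definition start_vertex :=
  search 10 12 13 14 start_test ;; PIf 13 (PAdd 8 14 7) (PConst 8 0) ;;
  PStore 3 8 ;; PConst 2 1 ;; PAdd 15 5 8 ;; PStore 15 1 ;; PConst 6 1.
Definition target_test :=
  PAdd 15 10 1 ;; PFetch 15 15 ;; PAdd 17 5 10 ;; PFetch 17 17 ;;
  PIf 15 (PConst 12 0) (PIf 17 (PConst 12 0) (PConst 12 1)).
Definition target := search 10 12 13 14 target_test ;; PIf 13 (PAdd 9 14 7) (PAdd 9 8 7).
Definition restart := PStore 3 9 ;; PConst 2 1.
Definition print_path :=
  PFor 86 (PSub 88 2 86 ;;
           PIf 88 (PAdd 88 3 86 ;; PFetch 88 88 ;; PPrint 88) (PConst 88 0)).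
Definition main :=
  layout ;; start_vertex ;; labels true ;; target ;; labels false ;; restart ;;
  PFor 18 desc ;; PFor 84 improve ;; print_path.
(** Register 7 is still 0, so the first instruction loads cell 0, which holds [n], as the loop
    bound. *)
Definition main_cmd := Seq (Fetch 0 7) (Seq (Const 1 1) (code main)).

(** * Correctness of the labelling *)

Section Labels.
Variables (n : nat) (G : sgraph 'I_n) (B : {set 'I_n}).
Implicit Types (s : state) (p q : seq 'I_n) (lab : 'I_n -> nat) (a u v : 'I_n).

Local Notation simple := (simple_path G).
Local Notation base := (1 + n + n * n).
Local Notation core := (core G B).
Local Notation inv := (inv G B).

Lemma inv_store_lab s p lab x y v :
  reg s x = base + n + n + v -> inv s p lab ->
  inv (den (PStore x y) s) p (fun u => if u == v then reg s y else lab u).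
Proof.
move=> rx I; have le_p := inv_size I; have [C [r2 Hp] Sp] := I.
split=> //.
  split; rewrite ?den_reg ?out_store //; try by case: C.
    by move=> b lt_b; rewrite ram_store rx (core_in C) // ltn_eqF //; lia.
  by move=> u; rewrite ram_store rx eqn_add2l (core_lab C).
split; first by rewrite den_reg.
by move=> k lt_k; rewrite ram_store rx Hp // ltn_eqF //; lia.
Qed.

Definition allowed (avoid : bool) v := avoid ==> (v \notin B).

Section Spread.
Variables (avoid : bool) (a : 'I_n) (X : {set 'I_n}).
Hypothesis closedX : forall u v, u \in X -> G u v -> allowed avoid v -> v \in X.

(** [c] bounds the labels, so that the next one exceeds them all. *)
Definition labelling lab c :=
  [/\ lab a = 1, forall u, lab u <= c,
      forall v, 0 < lab v -> v = a \/ exists2 u, G u v & 0 < lab u < lab v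
    & forall v, 0 < lab v -> v \in X].

(** The new label exceeds all others, in particular that of the neighbour found. Vertices labelled
    earlier keep their smaller neighbours, since [v] had no label and was none of these. *)
Lemma label_vertex_spec s p lab v :
  inv s p lab -> reg s 60 = v -> labelling lab (reg s 6) ->
  let s' := den (label_vertex avoid) s in
  exists lab', [/\ inv s' p lab', labelling lab' (reg s' 6),
    forall u, 0 < lab u -> 0 < lab' u
    & allowed avoid v -> (exists2 u, G u v & 0 < lab u) -> 0 < lab' v].
Proof.
move=> I r60 [la lec chain lX] s'; rewrite /s' /label_vertex; dens.
set s1 := den (PFetch 63 62) _; have I1 : inv s1 p lab by rewrite /s1; keep.
have [C _ _] := I; have [C1 _ _] := I1.
have r63 : reg s1 63 = lab v by rewrite /s1; regs; rewrite (core5 C) r60 (core_lab C).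
have r62 : reg s1 62 = base + n + n + v by rewrite /s1; regs; rewrite (core5 C) r60.
have r6 : reg s1 6 = reg s 6 by rewrite /s1; regs.
have r60' : reg s1 60 = v by rewrite /s1; regs.
move: (s1) I1 C1 r63 r62 r6 r60' => {}s1 I1 C1 r63 r62 r6 r60'.
rewrite den_if r63 -lt0n; case: posnP => [lv0|lv] /=; last first.
  exists lab; split=> //; first by keep.
  by split=> //; regs; rewrite r6.
dens; set c := search 64 66 67 68 (label_test avoid).
pose Q k := if insub k is Some u then [&& G u v, 0 < lab u & allowed avoid v] else false.
have QQ u : Q u = [&& G u v, 0 < lab u & allowed avoid v].
  by rewrite /Q; have -> : insub (nat_of_ord u) = Some u by exact: valK.
have wc : [&& wf c, pure (label_test avoid) & ~~ writes c 7].
  by rewrite /c; case: (avoid); vm_compute.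
have wt : [&& ~~ writes (label_test avoid) 67, ~~ writes (label_test avoid) 68,
    66 != 67, 66 != 68 & 68 != 67].
  by case: (avoid); vm_compute.
have pc : pure c && low c by rewrite /c; case: (avoid); vm_compute.
have I2 : inv (den c s1) p lab by apply: inv_den I1.
have [w6 w60 w62] : [/\ ~~ writes c 6, ~~ writes c 60 & ~~ writes c 62].
  by rewrite /c; case: (avoid); vm_compute.
have test s2 : agree c s1 s2 -> reg s2 64 < n ->
    (reg (den (label_test avoid) s2) 66 != 0) = Q (reg s2 64).
  move=> ag lt_u; pose u := Ordinal lt_u; rewrite -[reg s2 64]/(nat_of_ord u) QQ.
  have I' : inv s2 p lab by apply: inv_agree ag I1; case/andP: pc.
  have [C' _ _] := I'; have [rE _ _] := ag.
  have r60'' : reg s2 60 = v by rewrite rE.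
  have r64 : reg s2 64 = u by [].
  rewrite /label_test /allowed; case: (avoid); regs.
    rewrite (@adj_spec n G B _ lab u v); last 3 first.
    + by keep.
    + by regs; rewrite (core7 C') addn0.
    + by regs; rewrite (core7 C') addn0.
    rewrite (core5 C') r64 (core_lab C') r60'' (core1 C') (core_B _ C') /=.
    by case: (G u v) => //=; case: (lab u) => //= _; case: (v \in B).
  rewrite (@adj_spec n G B _ lab u v); last 3 first.
  + by keep.
  + by regs; rewrite (core7 C') addn0.
  + by regs; rewrite (core7 C') addn0.
  rewrite (core5 C') r64 (core_lab C') /=.
  by case: (G u v) => //=; case: (lab u).
case: (@search_spec 64 66 67 68 (label_test avoid) s1 n Q wc wt
         (core0 C1) (core1 C1) (core7 C1) test) => [[r67 nQ] | [r67 lt_u Qu]].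
  rewrite den_if r67 /=; exists lab; split=> //.
  - by keep.
  - by split=> //; regs; rewrite den_reg // r6.
  move=> av [u Gu lu]; have := nQ u (ltn_ord u).
  by rewrite QQ Gu lu av.
rewrite -/c in r67 lt_u Qu; rewrite den_if r67 /=; dens.
pose u := Ordinal lt_u; rewrite -[reg _ 68]/(nat_of_ord u) QQ in Qu.
have [Gu lu av] := and3P Qu; set c' := (reg s 6).+1.
set s3 := den (PAdd 6 6 1) (den c s1).
have I3 : inv s3 p lab by rewrite /s3; keep.
have r6' : reg s3 6 = c'.
  by have [C2 _ _] := I2; rewrite /s3 reg_add (den_reg _ w6) r6 (core1 C2) addn1.
exists (fun u => if u == v then c' else lab u); split.
- rewrite -r6'; apply: inv_store_lab I3; rewrite /s3; regs.
  by rewrite den_reg.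
- rewrite den_reg // r6'; split.
  + by case: eqVneq => // av'; rewrite -av' la in lv0.
  + by move=> w; case: ifP => _; [exact: leqnn | exact: leqW (lec w)].
  + move=> w; case: eqVneq => [->|wv] lw.
      right; exists u => //; case: eqVneq => [uv|_]; first by rewrite uv lv0 in lu.
      by rewrite lu ltnS lec.
    case: (chain w lw) => [->|[z Gz lz]]; [by left | right; exists z => //].
    by case: eqVneq => // zv; rewrite zv lv0 in lz.
  + move=> w; case: eqVneq => [-> _|_]; last exact: lX.
    by apply: closedX Gu av; apply: lX.
- by move=> w lw; case: ifP.
by rewrite eqxx.
Qed.

Lemma label_round_spec s p lab :
  inv s p lab -> labelling lab (reg s 6) ->
  let s' := den (label_round avoid) s in
  exists lab', [/\ inv s' p lab', labelling lab' (reg s' 6),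
    forall u, 0 < lab u -> 0 < lab' u
    & forall u v, G u v -> allowed avoid v -> 0 < lab u -> 0 < lab' v].
Proof.
move=> I L s'; have [C _ _] := I.
pose J k s' := exists lab', [/\ inv s' p lab', labelling lab' (reg s' 6),
    forall u, 0 < lab u -> 0 < lab' u
    & forall u v, v < k -> G u v -> allowed avoid v -> 0 < lab u -> 0 < lab' v].
suff: J n s' by case=> lab' [A1 A2 A3 A4]; exists lab'; split=> // u v; apply: A4.
apply: for_rule.
- exact: core0 C.
- exact: core1 C.
- by case: (avoid); vm_compute.
- by exists lab; split; [keep | regs | |].
move=> k s1 lt_k rk [lab1 [I1 L1 m1 H1]].
have [lab2 [I2 L2 m2 H2]] := @label_vertex_spec s1 p lab1 (Ordinal lt_k) I1 rk L1.
exists lab2; split=> //; first by keep.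
- by move=> u /m1/m2.
move=> u v; rewrite ltnS leq_eqVlt => /predU1P[vk|lt_v] Gu av lu.
  have def_v : v = Ordinal lt_k by exact: val_inj.
  by rewrite def_v in Gu av *; apply: H2 => //; exists u => //; apply: m1.
by apply: m2; apply: H1 lu.
Qed.

(** After [k] rounds the ends of all [E]-paths from [a] with at most [k] edges are labelled; a
    shortened path has fewer than [n] edges. *)
Lemma labels_spec s p lab (E : rel 'I_n) :
  (forall u v, E u v -> G u v && allowed avoid v) ->
  inv s p lab -> labelling lab (reg s 6) ->
  let s' := den (labels avoid) s in
  exists lab', [/\ inv s' p lab', labelling lab' (reg s' 6),
    forall u, 0 < lab u -> 0 < lab' u
    & forall v, connect E a v -> 0 < lab' v].
Proof.
move=> EG I L s'; have [C _ _] := I.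
pose J k s' := exists lab', [/\ inv s' p lab', labelling lab' (reg s' 6),
    forall u, 0 < lab u -> 0 < lab' u
    & forall r, path E a r -> size r <= k -> 0 < lab' (last a r)].
suff: J n s'.
  case=> lab' [A1 A2 A3 A4]; exists lab'; split=> // v /connectP[r + ->].
  case/shortenP=> r' ar' Ur' _; apply: A4 => //.
  by have := max_card (mem (a :: r')); rewrite (card_uniqP Ur') card_ord; apply: ltnW.
apply: for_rule.
- exact: core0 C.
- exact: core1 C.
- by case: (avoid); vm_compute.
- exists lab; split; [by keep | by regs | by [] |].
  by case=> // _ _; case: L => /= ->.
move=> k s1 lt_k rk [lab1 [I1 L1 m1 H1]].
have [lab2 [I2 L2 m2 H2]] := label_round_spec I1 L1.
exists lab2; split=> //; first by keep.
- by move=> u /m1/m2.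
case/lastP=> [_ _|r v]; first by case: L2 => /= ->.
rewrite rcons_path size_rcons last_rcons ltnS => /andP[ar Ev] sz_r.
by have [Gv av] := andP (EG _ _ Ev); apply: H2 Gv av _; apply: H1.
Qed.

End Spread.

(** * Initialisation, descent and output *)

Lemma layout_spec s :
  reg s 0 = n -> reg s 1 = 1 -> reg s 7 = 0 -> ram s = nth 0 (encode G B) -> out s = [::] ->
  core (den layout s) (fun=> 0).
Proof.
move=> r0 r1 r7 mE oE; rewrite /layout; dens.
set s1 := den (PFor 16 _) _.
have r3 : reg s1 3 = n * n.
  suff: reg s1 3 = n * n /\ reg s1 0 = n by case.
  apply: (for_rule (I := fun k s' => reg s' 3 = k * n /\ reg s' 0 = n)).
  - by regs.
  - by regs.
  - by vm_compute.
  - by split; regs.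
  by move=> k s' _ _ [r3 r0']; split; regs; rewrite // r3 r0' mulSn addnC.
have [m1 o1] : ram s1 = nth 0 (encode G B) /\ out s1 = [::].
  rewrite /s1 -denS; set c := PConst 3 0 ;; _.
  by rewrite (ram_den (c := c)) ?out_den.
have r0' : reg s1 0 = n by rewrite /s1; regs.
have r1' : reg s1 1 = 1 by rewrite /s1; regs.
have r7' : reg s1 7 = 0 by rewrite /s1; regs.
split; try by regs; rewrite ?r3 ?r0' ?r1'; lia.
- by move=> b _; regs; rewrite m1.
(* Cells beyond the input are 0, so all vertices start without a label. *)
- by move=> u; regs; rewrite m1 nth_default // size_encode; lia.
set s2 := den (PAdd 3 3 0) s1; rewrite -!denS; set c := _ ;; _.
by rewrite out_den // /s2 out_den.
Qed.

Lemma start_vertex_spec s :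
  0 < n -> core s (fun=> 0) ->
  let s' := den start_vertex s in
  exists a, [/\ inv s' [:: a] (fun u => if u == a then 1 else 0), reg s' 6 = 1,
    reg s' 8 = a & a \in B -> B = setT].
Proof.
move=> n_gt0 C s'; pose Q k := if insub k is Some u then (u : 'I_n) \notin B else false.
have QQ u : Q u = (u \notin B).
  by rewrite /Q; have -> : insub (nat_of_ord u) = Some u by exact: valK.
have test s2 : agree (search 10 12 13 14 start_test) s s2 -> reg s2 10 < n ->
    (reg (den start_test s2) 12 != 0) = Q (reg s2 10).
  move=> ag lt_u; pose u := Ordinal lt_u; rewrite -[reg s2 10]/(nat_of_ord u) QQ.
  have C' : core s2 (fun=> 0) by apply: core_agree ag C.
  have r10 : reg s2 10 = u by [].
  rewrite /start_test; regs; rewrite r10 (core1 C') (core_B _ C').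
  by case: (u \in B).
set c := search 10 12 13 14 start_test.
have [a def_a aB] : exists2 a : 'I_n,
    reg (den (PIf 13 (PAdd 8 14 7) (PConst 8 0)) (den c s)) 8 = a
    & a \in B -> B = setT.
  case: (@search_spec 10 12 13 14 start_test s n Q isT isT
           (core0 C) (core1 C) (core7 C) test) => [[r13 nQ] | [r13 lt_u Qu]].
    exists (Ordinal n_gt0); first by regs; rewrite r13.
    by move=> _; apply/setP=> u; rewrite inE; have := nQ u (ltn_ord u); rewrite QQ negbK.
  exists (Ordinal lt_u); first by regs; rewrite r13 (core7 C) addn0.
  by rewrite -[reg _ 14]/(nat_of_ord (Ordinal lt_u)) QQ in Qu; rewrite (negPf Qu).
rewrite /s' /start_vertex; dens; move: def_a; set s1 := den (PIf _ _ _) _ => def_a.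
have C1 : core s1 (fun=> 0) by rewrite /s1; keep.
exists a; split=> //; try by regs.
have C2 : core (den (PConst 2 1) (den (PStore 3 8) s1)) (fun=> 0).
  by keep; apply: core_store => //; rewrite (core3 C1); lia.
have I2 : inv (den (PConst 2 1) (den (PStore 3 8) s1)) [:: a] (fun=> 0).
  split=> //; split; first by regs.
  by case=> // _; regs; rewrite (core3 C1) addn0 eqxx def_a.
suff -> : (fun u => if u == a then 1 else 0) = (fun u => if u == a then
    reg (den (PAdd 15 5 8) (den (PConst 2 1) (den (PStore 3 8) s1))) 1 else 0).
  keep; apply: inv_store_lab; last by keep.
  by regs; rewrite (core5 C1) def_a.
by regs; rewrite (core1 C1).
Qed.

Lemma target_spec s p lab a :
  inv s p lab -> reg s 8 = a ->
  let s' := den target s in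
  exists2 w : 'I_n, reg s' 9 = w &
    (w \notin B /\ lab w = 0) \/ (w = a /\ forall v, v \notin B -> 0 < lab v).
Proof.
move=> I r8 s'; have [C _ _] := I.
pose Q k := if insub k is Some u then ((u : 'I_n) \notin B) && (lab u == 0) else false.
have QQ u : Q u = (u \notin B) && (lab u == 0).
  by rewrite /Q; have -> : insub (nat_of_ord u) = Some u by exact: valK.
have test s2 : agree (search 10 12 13 14 target_test) s s2 -> reg s2 10 < n ->
    (reg (den target_test s2) 12 != 0) = Q (reg s2 10).
  move=> ag lt_u; pose u := Ordinal lt_u; rewrite -[reg s2 10]/(nat_of_ord u) QQ.
  have C' : core s2 lab by apply: core_agree ag C.
  have r10 : reg s2 10 = u by [].
  rewrite /target_test; regs.
  rewrite r10 (core1 C') (core5 C') (core_B _ C') (core_lab C').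
  by case: (u \in B); case: (lab u).
rewrite /s' /target; dens.
case: (@search_spec 10 12 13 14 target_test s n Q isT isT
         (core0 C) (core1 C) (core7 C) test) => [[r13 nQ] | [r13 lt_u Qu]].
  exists a; first by regs; rewrite r13 /= r8 (core7 C) addn0.
  by right; split=> // v vB; have := nQ v (ltn_ord v); rewrite QQ vB lt0n.
exists (Ordinal lt_u); first by regs; rewrite r13 (core7 C) addn0.
left; rewrite -[reg _ 14]/(nat_of_ord (Ordinal lt_u)) QQ in Qu.
by case/andP: Qu => ? /eqP.
Qed.

Lemma restart_spec s p lab (w : 'I_n) :
  inv s p lab -> reg s 9 = w -> inv (den restart s) [:: w] lab.
Proof.
move=> [C _ _] r9; have := ltn_ord w => lt_w; split=> //.
  by rewrite /restart; dens; keep; apply: core_store => //; rewrite (core3 C); lia.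
split; first by rewrite /restart; regs.
by case=> // _; rewrite /restart; regs; rewrite (core3 C) addn0 eqxx.
Qed.

(** Away from [a] there is always a neighbour with smaller positive label, so each round adds a
    vertex until [a] is reached; a simple path leaves no room for [n] additions. *)
Lemma descend_spec s (w : 'I_n) lab a c (X : {set 'I_n}) :
  inv s [:: w] lab -> labelling a X lab c -> (forall v, 0 < lab v) ->
  exists2 p, inv (den (PFor 18 desc) s) p lab & exists2 t, p = w :: t & last w t = a.
Proof.
move=> I [la lec chain _] lpos; have [C _ _] := I.
pose J k s' := exists t, [/\ inv s' (w :: t) lab,
  forall u, u \in w :: t -> lab (last w t) <= lab u & last w t = a \/ k <= size t].
suff: J n (den (PFor 18 desc) s).
  case=> t [It _ Ht]; exists (w :: t) => //; exists t => //.
  by case: Ht => // le_n; have := inv_size It; rewrite /= ltnNge le_n.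
apply: for_rule.
- exact: core0 C.
- exact: core1 C.
- by vm_compute.
- exists [::]; split=> //; [by keep | by move=> u; rewrite inE => /eqP-> | by right].
move=> k s1 lt_k rk [t [It Lt Ht]].
have [q Hq Iq] := desc_spec It erefl Lt.
case: Hq => [[v /and3P[Gv lv lt_v] def_q] | [def_q nQ]].
  exists (rcons t v); rewrite -rcons_cons -def_q; split; first by keep.
    move=> u; rewrite def_q mem_rcons last_rcons inE => /predU1P[->//|/Lt le_u].
    exact: leq_trans (ltnW lt_v) le_u.
  (* At [a] the label is 1, and no positive label is smaller. *)
  right; case: Ht => [last_a|]; last by rewrite size_rcons.
  by have := lpos v; rewrite last_a la in lt_v; lia.
exists t; rewrite -def_q; split=> //; [by keep | by rewrite def_q |].
left; case: (chain _ (lpos (last w t))) => // -[u Gu Hu].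
by have := nQ u; rewrite edge_sym Gu Hu.
Qed.

Lemma print_spec s p lab :
  inv s p lab -> out (den print_path s) = [seq val v | v <- p].
Proof.
move=> I; have [C [r2 Hp] _] := I; have le_p := inv_size I.
pose J k s' := [/\ ram s' = ram s, reg s' 2 = size p, reg s' 3 = base, reg s' 1 = 1 &
  out s' = take k [seq val v | v <- p]].
suff: J n (den print_path s) by case=> _ _ _ _ ->; rewrite take_oversize // size_map.
apply: for_rule.
- exact: core0 C.
- exact: core1 C.
- by vm_compute.
- by split; regs; rewrite ?take0 ?(core3 C) ?(core1 C) // out_start (core_out C).
move=> k s1 lt_k rk [m1 r2' r3' r1' o1]; split; try by regs.
- rewrite ram_tick; dens; rewrite den_if.
  by case: ifP => _; dens; regs; rewrite ?ram_print; regs.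
rewrite out_tick; dens; rewrite den_if; regs; rewrite r2' rk subn_eq0 -ltnNge.
case: ltnP => [lt_kp|le_pk]; dens.
  rewrite out_print; regs; rewrite r3' rk m1 Hp //.
  rewrite (@out_den (PFetch 88 88) _ isT) (@out_den (PAdd 88 3 86) _ isT).
  rewrite (@out_den (PSub 88 2 86) _ isT) o1 -take_nth ?size_map //.
rewrite (@out_den (PConst 88 0) _ isT) (@out_den (PSub 88 2 86) _ isT).
by rewrite o1 !take_oversize ?size_map // leqW.
Qed.

(* The whole algorithm *)
Opaque layout start_vertex labels target restart print_path.

Lemma main_spec s :
  connectedG G -> reg s 0 = n -> reg s 1 = 1 -> reg s 7 = 0 ->
  ram s = nth 0 (encode G B) -> out s = [::] ->
  exists p, [/\ out (den main s) = [seq val v | v <- p], simple p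
    & minn (n - #|B| - 1) (2 * min_degree (del_vertices G B)) <= path_length p].
Proof.
move=> Gc r0 r1 r7 mE oE; have n_gt0 : 0 < n by case/andP: Gc; rewrite card_ord.
rewrite /main; dens; have C := layout_spec r0 r1 r7 mE oE.
have [a [I1 r6 r8 aB]] := start_vertex_spec n_gt0 C.
move: (den start_vertex _) I1 r6 r8 => s1 I1 r6 r8.
(* For [a] outside [B] this is the component of [a] in [G - B]; it confines the first stage. *)
pose X := [set v | (a \in B) || (v \notin B) && connect (edge_out G B) a v].
have clX u v : u \in X -> G u v -> allowed true v -> v \in X.
  rewrite !inE /allowed /=; case: (a \in B) => //= /andP[uB au] Guv vB.
  by rewrite vB; apply: connect_trans au (connect1 _); rewrite /edge_out Guv uB.
have L1 : labelling a X (fun u => if u == a then 1 else 0) (reg s1 6).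
  rewrite r6; split; first by rewrite eqxx.
  - by move=> u; case: ifP.
  - by move=> v; case: eqVneq => // ->; left.
  - by move=> v; case: eqVneq => // -> _; rewrite inE connect0 andbT orbN.
have [|lab1 [I2 L2 _ H2]] := labels_spec clX (E := edge_out G B) _ I1 L1.
  by move=> u v /and3P[Guv _ vB]; rewrite Guv.
have r8' : reg (den (labels true) s1) 8 = a by regs.
move: (den (labels true) _) I2 L2 r8' => s2 I2 L2 r8'.
have [w r9 Hw] := target_spec I2 r8'.
have I3 : inv (den target s2) [:: a] lab1 by keep.
have L3 : labelling a setT lab1 (reg (den target s2) 6).
  by regs; case: L2 => la lec ch _; split=> // v _; rewrite inE.
have r9' : reg (den (labels false) (den target s2)) 9 = w by regs.
have [||lab2 [I4 L4 _ H4]] := @labels_spec false a setT _ _ _ _ G _ I3 L3.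
- by move=> u v; rewrite !inE.
- by move=> u v ->.
have lpos v : 0 < lab2 v by apply: H4; case/andP: Gc => _ /forallP/(_ a)/forallP.
have [p0 I5 [t def_p0 last_a]] := descend_spec (restart_spec I4 r9') L4 lpos.
have [_ _ S0] := I5.
have P0 : promising G B p0.
  have [/aB -> | naB] := boolP (a \in B); first by apply: Or31; rewrite setCT cards0.
  case: Hw => [[wB lw0] | [wa lB]].
    apply: Or33; exists w, t; rewrite last_a; split=> //.
    (* The first stage would have labelled [w] if it were connected to [a] in [G - B]. *)
    by apply/negP=> wa; have := H2 w; rewrite connect_out_sym wa lw0 => /(_ isT).
  (* A simple path from [a] to [a] has a single vertex. *)
  have -> : p0 = [:: a].
    rewrite def_p0 wa in S0 *; case/lastP: t last_a S0 {def_p0} => // t b.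
    by rewrite last_rcons => -> /simple_uniq /=; rewrite mem_rcons mem_head.
  apply: promising1 => // v vB; case: L2 => _ _ _ /(_ v (lB v vB)).
  by rewrite inE (negPf naB) vB.
have wi : wf (PFor 84 improve) by vm_compute.
have [q Rq I6] := implements_for (isT : 7 < 84) wi (@improve_spec n G B) I5.
rewrite -[n in riter _ n]card_ord in Rq.
have [Sq le_q] := improve_promising (@min_degree_del _ G B) S0 P0 Rq.
exists q; split=> //; first exact: print_spec I6.
rewrite cardsCs setCK card_ord in le_q; rewrite /path_length.
move: (n - #|B|) (min_degree _) (size q) le_q; clear; lia.
Qed.

End Labels.

Theorem theorem18 :
  (forall (T : finType) (G : sgraph T), connectedG G ->
     forall B : {set T},
     exists p : seq T,
       simple_path G p /\
       minn (#|T| - #|B| - 1) (2 * min_degree (del_vertices G B)) <= path_length p)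
  /\
  (exists (c : cmd) (P : {poly nat}),
     forall (n : nat) (G : sgraph 'I_n), connectedG G ->
     forall B : {set 'I_n},
     exists (t : nat) (p : seq 'I_n),
       [/\ computes_in c (encode G B) t [seq nat_of_ord v | v <- p],
           t <= (P.[size (encode G B)])%R,
           simple_path G p
         & minn (n - #|B| - 1) (2 * min_degree (del_vertices G B)) <= path_length p]).
Proof.
split; first by move=> T G Gc B; apply: long_path_exists.
(* The constant 2 pays for the two instructions in front of [code main]. *)
exists main_cmd, (cost main + 2%:P)%R => n G Gc B.
pose s0 := init_state (encode G B).
pose s1 := set_reg s0 0 (ram s0 (reg s0 7)); pose s2 := set_reg s1 1 1.
(* The cost polynomial may thus be evaluated at the input size, which bounds register 0. *)
have le_n : n <= size (encode G B) by rewrite size_encode; lia.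
have wm : wf main by vm_compute.
have r0 : reg s2 0 = n by [].
have [t le_t et] := code_exec wm (erefl : reg s2 1 = 1) (leq_trans (eq_leq r0) le_n).
have [p [op Sp le_p]] := @main_spec n G B s2 Gc r0 erefl erefl erefl erefl.
exists (1 + (1 + t)), p; split=> //.
  exists (den main s2) => //; apply: exec_Seq; first exact: exec_Fetch.
  by apply: exec_Seq et; exact: exec_Const.
by rewrite hornerD hornerC addnA addnC; exact: leq_add le_t (leqnn 2).
Qed.
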